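(* Let $Q(x,t)$ be a smooth potential with values in $so(9)$ of the block form $$Q=\begin{pmatrix}0&\boldsymbol q&0\\ \boldsymbol p&0&\tilde{\boldsymbol q}\\ 0&\tilde{\boldsymbol p}&0\end{pmatrix},\qquad \tilde{\boldsymbol q}=s_1\boldsymbol q^Ts_1,\quad \tilde{\boldsymbol p}=s_1\boldsymbol p^Ts_1,$$ with $3\times 3$ blocks, satisfying the $\mathbb{Z}_6$-reduction condition $A_1QA_1^{-1}=Q$ and the $\mathbb{Z}_2$-reduction condition $Q=Q^\dagger$. Then: (i) There are complex functions $q_1(x,t),q_2(x,t)$ such that $$\boldsymbol q=\begin{pmatrix} q_1 & q_2 & -q_1 \\ -q_1 & -q_2 & q_1 \\ {q_1} & q_2 & -q_1 \end{pmatrix},\qquad \boldsymbol p=\boldsymbol q^\dagger .$$ (ii) The compatibility condition $[L,M]=0$ (for all $\lambda\in\mathbb{C}$) of the Lax pair $L,M$ described in the context is equivalent to the 2-component NLS system $$i\partial_t q_1+\partial_x^2q_1+6(|q_1|^2+|q_2|^2)q_1-3q_2^2q_1^*=0,$$ $$i\partial_t q_2+\partial_x^2q_2+3(4|q_1|^2+|q_2|^2)q_2-6q_1^2q_2^*=0 .$$ (iii) In the variables $v_1=\sqrt{6}\,q_1$, $v_2=\sqrt{3}\,q_2$ this system becomes $$i\partial_t v_1+\partial_x^2v_1+(|v_1|^2+2|v_2|^2)v_1-v_2^2v_1^*=0,$$ $$i\partial_t v_2+\partial_x^2v_2+(2|v_1|^2+|v_2|^2)v_2-v_1^2v_2^*=0,$$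 and it coincides with the Hamiltonian equations $i\,\partial_t v_j=\delta H'/\delta v_j^*$, $j=1,2$, where $H'$ is the functional with density $$|\partial_xv_1|^2+|\partial_xv_2|^2-\tfrac12\left(|v_1|^2+|v_2|^2\right)^2+\tfrac12\left(v_1v_2^*-v_1^*v_2\right)^2 .$$
   Context: $^*$ denotes complex conjugation, $^\dagger$ the Hermitian conjugate. All $9\times 9$ matrices are written in $3\times3$ blocks of size $3\times 3$. $so(9)$ is the Lie algebra of complex $9\times9$ matrices $X$ with $X+S_0X^TS_0^{-1}=0$, where $$S_0=\begin{pmatrix} 0 & 0 & s_1 \\ 0 & -s_1 & 0 \\ {s_1} & 0 & 0 \end{pmatrix},\qquad s_1=\begin{pmatrix} 0 & 0 & 1 \\ 0 & -1 & 0 \\ 1 & 0 & 0 \end{pmatrix}.$$ $J=\mathrm{diag}(\mathbb{1}_3,0_3,-\mathbb{1}_3)$. The $\mathbb{Z}_6$ automorphism is $X\mapsto A_1XA_1^{-1}$ with $A_1=\mathrm{diag}(a_1,a_2,a_3)$ (block diagonal), $$a_1=\begin{pmatrix} 0 & 1 & 0 \\ 0 & 0 & 1 \\ -1 & 0 & 0 \end{pmatrix},\quad a_2=\begin{pmatrix} 0 & 0 & 1 \\ 0 & -1 & 0 \\ 1 & 0 & 0 \end{pmatrix},\quad a_3=\begin{pmatrix} 0 & 0 & -1 \\ -1 & 0 & 0 \\ 0 & -1 & 0 \end{pmatrix}.$$ Lax pair: $L=i\partial_x+Q(x,t)-\lambda J$ and $M=i\partial_t+iQ_{1,x}+V_2+\lambda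 Q-\lambda^2J$, where $$Q_1=\begin{pmatrix} 0 & \boldsymbol q & 0 \\ -\boldsymbol p & 0 & \tilde{\boldsymbol q} \\ 0 & -\tilde{\boldsymbol p} & 0 \end{pmatrix}\quad(\text{so }[J,Q_1]=Q),\qquad V_2=\tfrac12[Q_1,Q].$$ $\delta/\delta v_j^*$ is the variational derivative treating $v_j$ and $v_j^*$ as independent; fields are assumed to decay sufficiently fast as $|x|\to\infty$ for $H'$ and its variational derivatives to make sense. *)

(* Defs.v *)
From HB Require Import structures.
From mathcomp Require Import all_boot all_order all_algebra.
From mathcomp Require Import complex.
From mathcomp Require Import all_classical all_reals all_analysis.
Set Implicit Arguments.
Unset Strict Implicit.
Unset Printing Implicit Defensive.
Import Order.TTheory GRing.Theory Num.Theory.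
Import numFieldNormedType.Exports.
Local Open Scope classical_set_scope.
Local Open Scope ring_scope.
Local Open Scope sesquilinear_scope.

(* Everything below is over an arbitrary realType R, with C = R[i].  In
   ring_scope, 'i, z^* and `|z| are the imaginary unit, the conjugate and the
   (real, but C-valued) modulus; A ^t* is the Hermitian conjugate. *)

Section Matrices.
Variable C : fieldType.

Definition mx3 (rows : seq (seq C)) : 'M[C]_3 :=
  \matrix_(i < 3, j < 3) (nth [::] rows i)`_j.

Definition block3 (A11 A12 A13 A21 A22 A23 A31 A32 A33 : 'M[C]_3) :
    'M[C]_(3 + (3 + 3)) :=
  block_mx A11 (row_mx A12 A13)
           (col_mx A21 A31) (block_mx A22 A23 A32 A33).

Definition mxcomm n (A B : 'M[C]_n) : 'M[C]_n := A *m B - B *m A.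

Definition s1 : 'M[C]_3 :=
  mx3 [:: [:: 0;  0; 1];
          [:: 0; -1; 0];
          [:: 1;  0; 0]].

Definition S0 : 'M[C]_(3 + (3 + 3)) :=
  block3  0   0    s1
          0 (- s1) 0
          s1  0    0.

Definition in_so9 (X : 'M[C]_(3 + (3 + 3))) : Prop :=
  X + S0 *m X^T *m invmx S0 = 0.

Definition J : 'M[C]_(3 + (3 + 3)) :=
  block3 1%:M 0 0
         0    0 0
         0    0 (- 1%:M).

Definition a1 : 'M[C]_3 :=
  mx3 [:: [::  0; 1; 0];
          [::  0; 0; 1];
          [:: -1; 0; 0]].

Definition a2 : 'M[C]_3 :=
  mx3 [:: [:: 0;  0; 1];
          [:: 0; -1; 0];
          [:: 1;  0; 0]].

Definition a3 : 'M[C]_3 :=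
  mx3 [:: [::  0;  0; -1];
          [:: -1;  0;  0];
          [::  0; -1;  0]].

Definition A1 : 'M[C]_(3 + (3 + 3)) :=
  block3 a1 0  0
         0  a2 0
         0  0  a3.

Definition tilde (q : 'M[C]_3) : 'M[C]_3 := s1 *m q^T *m s1.

Definition potential (q p : 'M[C]_3) : 'M[C]_(3 + (3 + 3)) :=
  block3 0 q         0
         p 0         (tilde q)
         0 (tilde p) 0.

Definition potential1 (q p : 'M[C]_3) : 'M[C]_(3 + (3 + 3)) :=
  block3 0     q             0
         (- p) 0             (tilde q)
         0     (- (tilde p)) 0.

Definition reduced_q (q1 q2 : C) : 'M[C]_3 :=
  mx3 [:: [::   q1;   q2; - q1];
          [:: - q1; - q2;   q1];
          [::   q1;   q2; - q1]].

End Matrices.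

Section ComplexCalculus.
Variable R : realType.
Local Notation C := R[i].
Local Notation re := (@complex.Re R).
Local Notation im := (@complex.Im R).
Local Notation mu := (@lebesgue_measure R).

(* C-valued functions of real variables are differentiated and integrated
   through their real and imaginary parts. *)
Definition is_cderive (f : R -> C) (x : R) (l : C) : Prop :=
  is_derive x 1 (re \o f) (re l) /\
  is_derive x 1 (im \o f) (im l).

Definition cderive (f : R -> C) (x : R) : C :=
  Complex (derive1 (re \o f) x) (derive1 (im \o f) x).

Definition cintegrable (f : R -> C) : Prop :=
  mu.-integrable setT (EFin \o (re \o f)) /\
  mu.-integrable setT (EFin \o (im \o f)).

Definition cintegral (f : R -> C) : C :=
  Complex (\int[mu]_x re (f x)) (\int[mu]_x im (f x)).

(* Functions of (x, t) are curried: f x t. *)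
Definition Dx (f : R -> R -> C) (x t : R) : C := cderive (f^~ t) x.
Definition Dt (f : R -> R -> C) (x t : R) : C := cderive (f x) t.

Definition mxDx m n (F : R -> R -> 'M[C]_(m, n)) (x t : R) : 'M[C]_(m, n) :=
  \matrix_(i, j) Dx (fun y s => F y s i j) x t.
Definition mxDt m n (F : R -> R -> 'M[C]_(m, n)) (x t : R) : 'M[C]_(m, n) :=
  \matrix_(i, j) Dt (fun y s => F y s i j) x t.

Fixpoint Cn2 (k : nat) (f : R -> R -> R) : Prop :=
  if k is k'.+1 then
    [/\ forall x t, derivable (f^~ t) x 1,
        forall x t, derivable (f x) t 1,
        Cn2 k' (fun x t => derive1 (f^~ t) x) &
        Cn2 k' (fun x t => derive1 (f x) t)]
  else continuous (fun z : R * R => f z.1 z.2).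

Definition smooth2 (f : R -> R -> C) : Prop :=
  forall k, Cn2 k (fun x t => re (f x t)) /\
            Cn2 k (fun x t => im (f x t)).

Definition mxsmooth m n (F : R -> R -> 'M[C]_(m, n)) : Prop :=
  forall i j, smooth2 (fun x t => F x t i j).

Definition smooth1 (f : R -> C) : Prop :=
  forall n x, derivable (derive1n n (re \o f)) x 1 /\
              derivable (derive1n n (im \o f)) x 1.

Definition test_function (f : R -> C) : Prop :=
  smooth1 f /\ exists A : R, forall x, A < `|x| -> f x = 0.

End ComplexCalculus.

Section Lax.
Variable R : realType.
Local Notation C := R[i].
Local Notation M9 := 'M[C]_(3 + (3 + 3)).
Local Notation field9 := (R -> R -> 'cV[C]_(3 + (3 + 3))).

Definition V2 (Q Q1 : M9) : M9 := 2^-1 *: mxcomm Q1 Q.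

Definition lax_L (Q : R -> R -> M9) (lam : C) (psi : field9) : field9 :=
  fun x t => 'i *: mxDx psi x t + (Q x t - lam *: J C) *m psi x t.

Definition lax_M (Q Q1 : R -> R -> M9) (lam : C) (psi : field9) : field9 :=
  fun x t => 'i *: mxDt psi x t +
    ('i *: mxDx Q1 x t + V2 (Q x t) (Q1 x t) + lam *: Q x t - lam ^+ 2 *: J C)
      *m psi x t.

(* [L, M] = 0 as an identity between differential operators, that is, on every
   smooth C^9-valued function. *)
Definition lax_compatible (Q Q1 : R -> R -> M9) : Prop :=
  forall (lam : C) (psi : field9), mxsmooth psi ->
  forall x t, lax_L Q lam (lax_M Q Q1 lam psi) x t
              - lax_M Q Q1 lam (lax_L Q lam psi) x t = 0.

End Lax.

Section NLS.
Variable R : realType.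
Local Notation C := R[i].
Local Notation re := (@complex.Re R).
Local Notation im := (@complex.Im R).

Definition nls_q (q1 q2 : R -> R -> C) (x t : R) : Prop :=
  'i * Dt q1 x t + Dx (Dx q1) x t
    + 6 * (`|q1 x t| ^+ 2 + `|q2 x t| ^+ 2) * q1 x t
    - 3 * q2 x t ^+ 2 * (q1 x t)^* = 0 /\
  'i * Dt q2 x t + Dx (Dx q2) x t
    + 3 * (4 * `|q1 x t| ^+ 2 + `|q2 x t| ^+ 2) * q2 x t
    - 6 * q1 x t ^+ 2 * (q2 x t)^* = 0.

Definition nls_v (v1 v2 : R -> R -> C) (x t : R) : Prop :=
  'i * Dt v1 x t + Dx (Dx v1) x t
    + (`|v1 x t| ^+ 2 + 2 * `|v2 x t| ^+ 2) * v1 x t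
    - v2 x t ^+ 2 * (v1 x t)^* = 0 /\
  'i * Dt v2 x t + Dx (Dx v2) x t
    + (2 * `|v1 x t| ^+ 2 + `|v2 x t| ^+ 2) * v2 x t
    - v1 x t ^+ 2 * (v2 x t)^* = 0.

(* A pair of fields at a fixed time. *)
Local Notation state := ('I_2 -> R -> C).

Definition state2 (v1 v2 : R -> R -> C) (t : R) : state :=
  fun j => if j == 0 then v1^~ t else v2^~ t.

Definition conj_state (v : state) : state := fun j x => (v j x)^*.

(* The density of H', with v_j^* replaced by an independent field w_j, so that
   v_j and v_j^* can be varied independently; see hamiltonian_density_conj. *)
Definition hamiltonian_density (v w : state) (x : R) : C :=
  cderive (v 0) x * cderive (w 0) x + cderive (v 1) x * cderive (w 1) x
  - 2^-1 * (v 0 x * w 0 x + v 1 x * w 1 x) ^+ 2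
  + 2^-1 * (v 0 x * w 1 x - w 0 x * v 1 x) ^+ 2.

Definition hamiltonian (v w : state) : C :=
  cintegral (hamiltonian_density v w).

Definition shift_state (w : state) (j : 'I_2) (f : R -> C) : state :=
  fun k x => if k == j then w k x + f x else w k x.

(* g = delta F / delta v_j^* at v : the first variation of F when v is kept
   fixed and its conjugate v^* is moved in its j-th component only. *)
Definition is_var_deriv_conj (F : state -> state -> C) (v : state) (j : 'I_2)
    (g : R -> C) : Prop :=
  forall eta : R -> C, test_function eta ->
    cintegrable (fun x => g x * eta x) /\
    is_cderive (fun eps : R =>
        F v (shift_state (conj_state v) j (fun x => (eps%:C)%C * eta x)))
      0 (cintegral (fun x => g x * eta x)).

Definition hamiltonian_eqs (v1 v2 : R -> R -> C) : Prop :=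
  forall (t : R) (j : 'I_2),
    is_var_deriv_conj hamiltonian (state2 v1 v2 t) j
      (fun x => 'i * Dt (if j == 0 then v1 else v2) x t).

Lemma cderive_conj (f : R -> C) (x : R) :
  derivable (im \o f) x 1 ->
  cderive (fun y => (f y)^*) x = (cderive f x)^*.
Proof.
move=> df.
have eRe : re \o (fun y => (f y)^*) = re \o f.
  by apply/funext => y /=; case: (f y).
have eIm : im \o (fun y => (f y)^*) = - (im \o f).
  by apply/funext => y; rewrite /= /GRing.opp /=; case: (f y).
by rewrite /cderive eRe eIm derive1N.
Qed.

Lemma hamiltonian_density_conj (v : state) (x : R) :
  (forall j, derivable (im \o v j) x 1) ->
  hamiltonian_density v (conj_state v) x =
    `|cderive (v 0) x| ^+ 2 + `|cderive (v 1) x| ^+ 2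
    - 2^-1 * (`|v 0 x| ^+ 2 + `|v 1 x| ^+ 2) ^+ 2
    + 2^-1 * (v 0 x * (v 1 x)^* - (v 0 x)^* * v 1 x) ^+ 2.
Proof.
by move=> dv; rewrite /hamiltonian_density /conj_state !cderive_conj// !normCK.
Qed.

End NLS.

(* Main.v *)
Require Import Defs.
From HB Require Import structures.
From mathcomp Require Import all_boot all_order all_algebra.
From mathcomp Require Import complex ring lra.
From mathcomp Require Import all_classical all_reals all_analysis.
Set Implicit Arguments.
Unset Strict Implicit.
Unset Printing Implicit Defensive.
Import Order.TTheory GRing.Theory Num.Theory.
Import numFieldNormedType.Exports.
Local Open Scope classical_set_scope.
Local Open Scope ring_scope.
Local Open Scope sesquilinear_scope.

(** Since mixed partial derivatives commute, the commutator of L = i d_x + U and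
    M = i d_t + V is multiplication by i V_x - i U_t + [U, V].  Its coefficients
    in lambda of positive degree vanish because [J, Q1] = Q and [J, V2] = 0.  The
    constant term has diagonal blocks built from q ~q_x - q_x ~q, which vanish for
    the rank-one matrices q allowed by the reductions; its off-diagonal blocks are,
    up to sign, Hermitian conjugation and ~, all equal to
    i q_t + q_xx + 2 q p q - q ~q ~p, the matrix form of the NLS system.

    The density of H' is quadratic in v_j^*, so along v_j^* + e eta the energy is a
    polynomial in e of degree 2 whose linear coefficient becomes, after integration
    by parts, the integral of eta times an explicit gradient.  Testing against
    bump functions made from exp(-1/x) identifies that gradient pointwise. *)

(** * Complex-valued functions of real variables *)

(** Calculus and algebra are kept apart. Complex functions are differentiated through real and
    imaginary parts, so the rules for sums, products and exchanged derivatives are proved for real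
    functions and lifted to complex scalars, then entrywise to matrices. In the matrix identities a
    field and its derivatives are independent letters, and p is not tied to q; conjugation is
    imposed only at the end, where the lower blocks repeat the NLS system in conjugate form.

    The reduced matrices factor as q = u r^T with u = (1,-1,1) and r = (q1,q2,-q1). Symmetry of the
    scalar r^T s1 r' makes q ~q' symmetric in the two matrices, and u^T u = 3 produces the
    coefficients of the system.

    In the Hamiltonian part, an integral over the whole line splits along the expansion in e when
    each piece is integrable. Perturbations have compact support, which settles the added pieces and
    removes boundary terms; integrability of the density at the unperturbed fields is the decay
    assumption, made at each time. *)

Lemma cReD (R : rcfType) (a b : R[i]) : complex.Re (a + b) = complex.Re a + complex.Re b.
Proof. by case: a => ? ?; case: b. Qed.

Lemma cImD (R : rcfType) (a b : R[i]) : complex.Im (a + b) = complex.Im a + complex.Im b.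
Proof. by case: a => ? ?; case: b. Qed.

Lemma cReM (R : rcfType) (a b : R[i]) :
  complex.Re (a * b) = complex.Re a * complex.Re b - complex.Im a * complex.Im b.
Proof. by case: a => ? ?; case: b. Qed.

Lemma cImM (R : rcfType) (a b : R[i]) :
  complex.Im (a * b) = complex.Re a * complex.Im b + complex.Im a * complex.Re b.
Proof. by case: a => ? ?; case: b. Qed.

Lemma cReJ (R : rcfType) (a : R[i]) : complex.Re a^* = complex.Re a.
Proof. by case: a. Qed.

Lemma cImJ (R : rcfType) (a : R[i]) : complex.Im a^* = - complex.Im a.
Proof. by case: a. Qed.

Lemma eq_complexP (R : rcfType) (a b : R[i]) :
  complex.Re a = complex.Re b -> complex.Im a = complex.Im b -> a = b.
Proof. by case: a => ? ?; case: b => ? ? /= -> ->. Qed.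

Section ComplexDerivative.
Variable R : realType.
Local Notation C := R[i].
Local Notation re := (@complex.Re R).
Local Notation im := (@complex.Im R).

Lemma derivable1D (f g : R -> R) (x : R) : derivable f x 1 -> derivable g x 1 ->
  derivable (fun y => f y + g y) x 1.
Proof. by move=> df dg; exact: (derivableD df dg). Qed.

Lemma derivable1N (f : R -> R) (x : R) : derivable f x 1 ->
  derivable (fun y => - f y) x 1.
Proof. by move=> df; exact: (derivableN df). Qed.

Lemma derivable1M (f g : R -> R) (x : R) : derivable f x 1 -> derivable g x 1 ->
  derivable (fun y => f y * g y) x 1.
Proof. by move=> df dg; exact: (derivableM df dg). Qed.

Lemma derive1D (f g : R -> R) (x : R) : derivable f x 1 -> derivable g x 1 ->
  derive1 (fun y => f y + g y) x = derive1 f x + derive1 g x.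
Proof.
move=> df dg; rewrite (derive1E (fun y => f y + g y)) (derive1E f) (derive1E g).
exact: (deriveD df dg).
Qed.

Lemma derive1M (f g : R -> R) (x : R) : derivable f x 1 -> derivable g x 1 ->
  derive1 (fun y => f y * g y) x = derive1 f x * g x + f x * derive1 g x.
Proof.
move=> df dg; rewrite (derive1E (fun y => f y * g y)) (derive1E f) (derive1E g).
by rewrite (deriveM df dg) addrC mulrC.
Qed.

Lemma is_derive1 (f : R -> R) (x : R) : derivable f x 1 -> is_derive x 1 f (derive1 f x).
Proof. by move=> df; rewrite derive1E; apply: derivableP. Qed.

Definition cderivable (f : R -> C) (x : R) : Prop :=
  derivable (re \o f) x 1 /\ derivable (im \o f) x 1.

Lemma is_cderiveP (f : R -> C) x : cderivable f x -> is_cderive f x (cderive f x).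
Proof. by move=> [df1 df2]; split; exact: is_derive1. Qed.

Lemma is_cderive_uniq (f : R -> C) x a b :
  is_cderive f x a -> is_cderive f x b -> a = b.
Proof.
move=> [ra ia] [rb ib]; apply: eq_complexP.
  by rewrite -(@derive_val _ _ _ _ _ _ _ ra) -(@derive_val _ _ _ _ _ _ _ rb).
by rewrite -(@derive_val _ _ _ _ _ _ _ ia) -(@derive_val _ _ _ _ _ _ _ ib).
Qed.

Lemma comp_ReD (f g : R -> C) :
  re \o (fun y => f y + g y) = (fun y => (re \o f) y + (re \o g) y).
Proof. by apply/funext => y; rewrite /= cReD. Qed.

Lemma comp_ImD (f g : R -> C) :
  im \o (fun y => f y + g y) = (fun y => (im \o f) y + (im \o g) y).
Proof. by apply/funext => y; rewrite /= cImD. Qed.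

Lemma comp_ReM (f g : R -> C) : re \o (fun y => f y * g y) =
  (fun y => (re \o f) y * (re \o g) y + - ((im \o f) y * (im \o g) y)).
Proof. by apply/funext => y; rewrite /= cReM. Qed.

Lemma comp_ImM (f g : R -> C) : im \o (fun y => f y * g y) =
  (fun y => (re \o f) y * (im \o g) y + (im \o f) y * (re \o g) y).
Proof. by apply/funext => y; rewrite /= cImM. Qed.

Lemma cderivableD (f g : R -> C) x : cderivable f x -> cderivable g x ->
  cderivable (fun y => f y + g y) x.
Proof.
move=> [f1 f2] [g1 g2]; split.
  by rewrite comp_ReD; exact: derivable1D.
by rewrite comp_ImD; exact: derivable1D.
Qed.

Lemma cderiveD (f g : R -> C) x : cderivable f x -> cderivable g x ->
  cderive (fun y => f y + g y) x = cderive f x + cderive g x.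
Proof.
move=> [f1 f2] [g1 g2]; apply: eq_complexP.
  by rewrite cReD /cderive /complex.Re comp_ReD (derive1D f1 g1).
by rewrite cImD /cderive /complex.Im comp_ImD (derive1D f2 g2).
Qed.

Lemma cderivableM (f g : R -> C) x : cderivable f x -> cderivable g x ->
  cderivable (fun y => f y * g y) x.
Proof.
move=> [f1 f2] [g1 g2]; split.
  rewrite comp_ReM; apply: derivable1D; first exact: derivable1M.
  by apply: derivable1N; exact: derivable1M.
by rewrite comp_ImM; apply: derivable1D; exact: derivable1M.
Qed.

Lemma cderiveM (f g : R -> C) x : cderivable f x -> cderivable g x ->
  cderive (fun y => f y * g y) x = cderive f x * g x + f x * cderive g x.
Proof.
move=> [f1 f2] [g1 g2]; apply: eq_complexP.
  rewrite cReD !cReM /cderive [in LHS]/complex.Re comp_ReM.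
  rewrite (derive1D (derivable1M f1 g1) (derivable1N (derivable1M f2 g2))).
  rewrite (@derive1N _ (fun y => _ * _) x (derivable1M f2 g2)).
  rewrite (derive1M f1 g1) (derive1M f2 g2) /=; ring.
rewrite cImD !cImM /cderive [in LHS]/complex.Im comp_ImM.
rewrite (derive1D (derivable1M f1 g2) (derivable1M f2 g1)).
rewrite (derive1M f1 g2) (derive1M f2 g1) /=; ring.
Qed.

Lemma cderivable_cst (c : C) x : cderivable (fun=> c) x.
Proof.
by split; [exact: (@derivable_cst R R R (re c) x 1)|
           exact: (@derivable_cst R R R (im c) x 1)].
Qed.

Lemma cderive_cst (c : C) x : cderive (fun=> c) x = 0.
Proof.
by apply: eq_complexP; [exact: (@derive1_cst R R (re c) x)|
                        exact: (@derive1_cst R R (im c) x)].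
Qed.

Lemma cderivableZ (c : C) (f : R -> C) x : cderivable f x ->
  cderivable (fun y => c * f y) x.
Proof. by move=> df; exact: (cderivableM (cderivable_cst c x) df). Qed.

Lemma cderiveZ (c : C) (f : R -> C) x : cderivable f x ->
  cderive (fun y => c * f y) x = c * cderive f x.
Proof.
move=> df; rewrite (cderiveM (cderivable_cst c x) df).
by rewrite cderive_cst mul0r add0r.
Qed.

Lemma cderivable_conj (f : R -> C) x : cderivable f x ->
  cderivable (fun y => (f y)^*) x.
Proof.
move=> [f1 f2]; split.
  by rewrite (_ : _ \o _ = re \o f)//; apply/funext => y; rewrite /= cReJ.
rewrite (_ : _ \o _ = fun y => - (im \o f) y); first exact: derivable1N.
by apply/funext => y; rewrite /= cImJ.
Qed.

Lemma cderivable_sum (I : Type) (s : seq I) (F : I -> R -> C) x :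
  (forall i, cderivable (F i) x) -> cderivable (fun y => \sum_(i <- s) F i y) x.
Proof.
move=> dF; elim: s => [|i s IHs].
  under eq_fun do rewrite big_nil.
  by apply: cderivable_cst.
under eq_fun do rewrite big_cons.
exact: (cderivableD (dF i) IHs).
Qed.

Lemma cderive_sum (I : Type) (s : seq I) (F : I -> R -> C) x :
  (forall i, cderivable (F i) x) ->
  cderive (fun y => \sum_(i <- s) F i y) x = \sum_(i <- s) cderive (F i) x.
Proof.
move=> dF; elim: s => [|i s IHs].
  under eq_fun do rewrite big_nil.
  by rewrite cderive_cst big_nil.
under eq_fun do rewrite big_cons.
rewrite (cderiveD (dF i) (cderivable_sum s dF)) IHs.
by rewrite big_cons.
Qed.

End ComplexDerivative.

(** * Smooth functions of two real variables and equality of mixed derivatives *)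

Section SmoothTwoVariables.
Variable R : realType.
Local Notation C := R[i].
Local Notation re := (@complex.Re R).
Local Notation im := (@complex.Im R).

Lemma Cn2D k (f g : R -> R -> R) : Cn2 k f -> Cn2 k g ->
  Cn2 k (fun x t => f x t + g x t).
Proof.
elim: k f g => [|k IHk] f g /=.
  by move=> cf cg z; apply: continuousD; [apply: cf|apply: cg].
move=> [fx ft cfx cft] [gx gt cgx cgt]; split=> [x t|x t||].
- exact: (derivable1D (fx x t) (gx x t)).
- exact: (derivable1D (ft x t) (gt x t)).
- under eq_fun do under eq_fun do rewrite (derive1D (fx _ _) (gx _ _)).
  exact: IHk.
- under eq_fun do under eq_fun do rewrite (derive1D (ft _ _) (gt _ _)).
  exact: IHk.
Qed.

(** The product rule needs [f] itself at order [k], while [Cn2 k.+1 f] speaks at that order of its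
    derivatives only. Hence the hypotheses at every order. *)
Lemma Cn2M k (f g : R -> R -> R) : (forall m, Cn2 m f) -> (forall m, Cn2 m g) ->
  Cn2 k (fun x t => f x t * g x t).
Proof.
elim: k f g => [|k IHk] f g sf sg /=.
  by move=> z; apply: continuousM; [apply: (sf 0%N)|apply: (sg 0%N)].
have [fx ft _ _] := sf 1%N; have [gx gt _ _] := sg 1%N.
have sfx m := let: And4 _ _ a _ := sf m.+1 in a.
have sft m := let: And4 _ _ _ a := sf m.+1 in a.
have sgx m := let: And4 _ _ a _ := sg m.+1 in a.
have sgt m := let: And4 _ _ _ a := sg m.+1 in a.
split=> [x t|x t||].
- exact: (derivable1M (fx x t) (gx x t)).
- exact: (derivable1M (ft x t) (gt x t)).
- under eq_fun do under eq_fun do rewrite (derive1M (fx _ _) (gx _ _)).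
  by apply: Cn2D; apply: IHk.
- under eq_fun do under eq_fun do rewrite (derive1M (ft _ _) (gt _ _)).
  by apply: Cn2D; apply: IHk.
Qed.

Lemma Cn2_cst k (c : R) : Cn2 k (fun _ _ => c).
Proof.
elim: k c => [|k IHk] c /=; first by move=> z; apply: cst_continuous.
by split=> [x t|x t||]; try exact: derivable_cst;
  under eq_fun do under eq_fun do rewrite (derive1_cst c).
Qed.

Lemma Cn2N k (f : R -> R -> R) : (forall m, Cn2 m f) -> Cn2 k (fun x t => - f x t).
Proof.
move=> sf; under eq_fun do under eq_fun do rewrite -mulN1r.
by apply: Cn2M => // m; apply: Cn2_cst.
Qed.

Lemma smooth2D (f g : R -> R -> C) : smooth2 f -> smooth2 g ->
  smooth2 (fun x t => f x t + g x t).
Proof.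
move=> sf sg k; split.
  under eq_fun do under eq_fun do rewrite cReD.
  by apply: Cn2D; [case: (sf k)|case: (sg k)].
under eq_fun do under eq_fun do rewrite cImD.
by apply: Cn2D; [case: (sf k)|case: (sg k)].
Qed.

Lemma smooth2M (f g : R -> R -> C) : smooth2 f -> smooth2 g ->
  smooth2 (fun x t => f x t * g x t).
Proof.
move=> sf sg k.
have rf m := (sf m).1; have rg m := (sg m).1.
have jf m := (sf m).2; have jg m := (sg m).2.
split.
  under eq_fun do under eq_fun do rewrite cReM.
  by apply: Cn2D; [apply: Cn2M|apply: Cn2N => m; apply: Cn2M].
under eq_fun do under eq_fun do rewrite cImM.
by apply: Cn2D; apply: Cn2M.
Qed.

Lemma smooth2_cst (c : C) : smooth2 (fun _ _ => c).
Proof. by move=> k; split; apply: Cn2_cst. Qed.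

Lemma smooth2Z (c : C) (f : R -> R -> C) : smooth2 f ->
  smooth2 (fun x t => c * f x t).
Proof. by move=> sf; exact: (smooth2M (smooth2_cst c) sf). Qed.

Lemma smooth2_conj (f : R -> R -> C) : smooth2 f -> smooth2 (fun x t => (f x t)^*).
Proof.
move=> sf k; split.
  under eq_fun do under eq_fun do rewrite cReJ.
  by case: (sf k).
under eq_fun do under eq_fun do rewrite cImJ.
by apply: Cn2N => m; case: (sf m).
Qed.

Lemma smooth2_sum (I : Type) (s : seq I) (F : I -> R -> R -> C) :
  (forall i, smooth2 (F i)) -> smooth2 (fun x t => \sum_(i <- s) F i x t).
Proof.
move=> dF; elim: s => [|i s IHs].
  under eq_fun do under eq_fun do rewrite big_nil.
  by apply: smooth2_cst.
under eq_fun do under eq_fun do rewrite big_cons.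
by apply: smooth2D.
Qed.

Lemma smooth2_Dx (f : R -> R -> C) : smooth2 f -> smooth2 (Dx f).
Proof. by move=> sf k; have [[_ _ ? _] [_ _ ? _]] := sf k.+1. Qed.

Lemma smooth2_Dt (f : R -> R -> C) : smooth2 f -> smooth2 (Dt f).
Proof. by move=> sf k; have [[_ _ _ ?] [_ _ _ ?]] := sf k.+1. Qed.

Lemma smooth2_cderivable_x (f : R -> R -> C) x t : smooth2 f -> cderivable (f^~ t) x.
Proof. by move=> sf; have [[fx _ _ _] [gx _ _ _]] := sf 1%N; split; [exact: fx|exact: gx]. Qed.

Lemma smooth2_cderivable_t (f : R -> R -> C) x t : smooth2 f -> cderivable (f x) t.
Proof. by move=> sf; have [[_ fx _ _] [_ gx _ _]] := sf 1%N; split; [exact: fx|exact: gx]. Qed.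

(* The second difference of f over a square of side h equals h^2 times either
   mixed derivative at some point of the square. *)
Lemma mixed_derivative_diff (f : R -> R -> R) x t h : 0 < h ->
  (forall x t, derivable (f^~ t) x 1) ->
  (forall x t, derivable (fun s => derive1 (f^~ s) x) t 1) ->
  exists2 z : R * R, (z.1 \in `]x, x + h[) /\ (z.2 \in `]t, t + h[) &
    f (x + h) (t + h) - f (x + h) t - (f x (t + h) - f x t) =
    derive1 (fun s => derive1 (f^~ s) z.1) z.2 * h * h.
Proof.
move=> h0 fx fxt.
have ltx : x < x + h by rewrite ltrDl.
have ltt : t < t + h by rewrite ltrDl.
have dg y : derivable (fun y => f y (t + h) - f y t) y 1.
  exact: (derivable1D (fx y (t + h)) (derivable1N (fx y t))).
have [||xi xiI E1] := @MVT R (fun y => f y (t + h) - f y t)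
    (fun y => derive1 (f^~ (t + h)) y - derive1 (f^~ t) y) x (x + h) ltx.
- move=> y _; rewrite !derive1E; apply: is_deriveB; exact: derivableP.
- by apply: derivable_within_continuous => y _; apply: dg.
have [||tau tauI E2] := @MVT R (fun s => derive1 (f^~ s) xi)
    (fun s => derive1 (fun s => derive1 (f^~ s) xi) s) t (t + h) ltt.
- by move=> s _; rewrite derive1E; apply: derivableP.
- by apply: derivable_within_continuous => s _; apply: fxt.
exists (xi, tau) => //=.
move: E1 E2; rewrite /= [x + h - x]addrC [t + h - t]addrC !addKr => E1 E2.
by rewrite -E2 -E1.
Qed.

(** The second difference is symmetric in the two variables, so on any small square both mixed
    derivatives take a common value, possibly at different points. By continuity each of these
    values is within e/2 of the value at the corner. *)
Lemma Cn2_mixed_derivatives (f : R -> R -> R) x t : (forall k, Cn2 k f) ->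
  derive1 (fun s => derive1 (f^~ s) x) t = derive1 (fun y => derive1 (f y) t) x.
Proof.
move=> sf; apply/eqP; rewrite -subr_eq0 -normr_le0; apply/ler_addgt0Pl => e e0.
rewrite addr0.
have cA : continuous (fun z : R * R => derive1 (fun s => derive1 (f^~ s) z.1) z.2).
  by have [_ _ [_ _ _ c] _] := sf 2%N.
have cB : continuous (fun z : R * R => derive1 (fun y => derive1 (f y) z.2) z.1).
  by have [_ _ _ [_ _ c _]] := sf 2%N.
have e20 : 0 < e / 2 by rewrite divr_gt0.
have /cvgrPdist_le/(_ _ e20) nA := cA (x, t).
have /cvgrPdist_le/(_ _ e20) nB := cB (x, t).
have [d [/= /nbhs_ballP[e1 /= e10 He1] /nbhs_ballP[e2 /= e20' He2]] Hd] :=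
  filterI nA nB.
have [fx ft [_ fxt _ _] [ftx _ _ _]] := sf 2%N.
pose h := Num.min e1 e2.
have h0 : 0 < h by rewrite lt_min e10 e20'.
have near_d y s : y \in `]x, x + h[ -> s \in `]t, t + h[ -> (d.1 `*` d.2) (y, s).
  rewrite !in_itv /= => /andP[y1 y2] /andP[s1 s2]; split => /=.
    apply: He1; rewrite /ball /= distrC ger0_norm; last by rewrite subr_ge0 ltW.
    by rewrite ltrBlDl (lt_le_trans y2)// lerD2l ge_min lexx.
  apply: He2; rewrite /ball /= distrC ger0_norm; last by rewrite subr_ge0 ltW.
  by rewrite ltrBlDl (lt_le_trans s2)// lerD2l ge_min lexx orbT.
have [[y s] /= [yI sI] E1] := mixed_derivative_diff x t h0 fx fxt.
have [[s' y'] /= [sI' yI'] E2] :=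
  mixed_derivative_diff (f := fun s y => f y s) t x h0 (fun s y => ft y s)
    (fun s y => ftx y s).
have [/= + _] := Hd _ (near_d _ _ yI sI).
have [/= _ +] := Hd _ (near_d _ _ yI' sI').
have -> : derive1 (fun s => derive1 (f^~ s) y) s =
          derive1 (fun y => derive1 (f y) s') y'.
  have hn0 : h != 0 by rewrite gt_eqF.
  apply: (mulIf hn0); apply: (mulIf hn0).
  have swap (a b c e' : R) : a - b - (c - e') = a - c - (b - e') by ring.
  move: E1 E2; rewrite /= swap.
  by move=> -> E2; exact: E2.
move=> HB HA; rewrite distrC in HB.
apply: (le_trans (ler_distD _ _ _)) (le_trans (lerD HA HB) _).
by rewrite -splitr.
Qed.

Lemma Dt_Dx (f : R -> R -> C) x t : smooth2 f -> Dt (Dx f) x t = Dx (Dt f) x t.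
Proof.
move=> sf; apply: eq_complexP.
  exact: (Cn2_mixed_derivatives x t (fun k => (sf k).1)).
exact: (Cn2_mixed_derivatives x t (fun k => (sf k).2)).
Qed.

End SmoothTwoVariables.

(** * Matrix-valued functions *)

(** Every term with a derivative of [p] cancels. The single letter [pxt] serves for both orders of
    differentiation: this is where equality of mixed derivatives enters. *)
Lemma commutator_zero_order (C : comNzRingType) n (k : C)
    (U V Ut Vx : 'M[C]_n) (p px pt pxt : 'cV[C]_n) :
  k *: (k *: pxt + (Vx *m p + V *m px)) + U *m (k *: pt + V *m p)
  - (k *: (k *: pxt + (Ut *m p + U *m pt)) + V *m (k *: px + U *m p))
  = (k *: Vx - k *: Ut + (U *m V - V *m U)) *m p.
Proof.
rewrite !mulmxDl !mulNmx -!scalemxAl !mulmxDr -!scalemxAr !mulmxA.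
rewrite [k *: (_ + (_ + V *m px))]scalerDr [k *: (_ + (_ + U *m pt))]scalerDr.
rewrite !(scalerDr k (_ *m p)).
(* With the products made opaque, a purely additive identity remains, which [ring] checks
   entrywise. *)
move: (k *: (k *: pxt)) (k *: (Vx *m p)) (k *: (V *m px)) (k *: (U *m pt)).
move: (k *: (Ut *m p)) (U *m V *m p) (V *m U *m p) => a b c d e f g.
apply/matrixP => i j; rewrite !mxE; ring.
Qed.

Section MatrixCalculus.
Variable R : realType.
Local Notation C := R[i].

Section Smoothness.
Variables (m n : nat).
Implicit Types (F G : R -> R -> 'M[C]_(m, n)).

Lemma mxsmooth_cst (A : 'M[C]_(m, n)) : mxsmooth (fun _ _ => A).
Proof. by move=> i j; exact: smooth2_cst. Qed.

Lemma mxsmoothD F G : mxsmooth F -> mxsmooth G -> mxsmooth (fun x t => F x t + G x t).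
Proof.
move=> sF sG i j; under eq_fun do under eq_fun do rewrite mxE.
exact: (smooth2D (sF i j) (sG i j)).
Qed.

Lemma mxsmoothZ (c : C) F : mxsmooth F -> mxsmooth (fun x t => c *: F x t).
Proof.
move=> sF i j; under eq_fun do under eq_fun do rewrite mxE.
exact: (smooth2Z c (sF i j)).
Qed.

Lemma mxsmooth_Dx F : mxsmooth F -> mxsmooth (mxDx F).
Proof.
move=> sF i j; under eq_fun do under eq_fun do rewrite mxE.
exact: (smooth2_Dx (sF i j)).
Qed.

Lemma mxsmooth_Dt F : mxsmooth F -> mxsmooth (mxDt F).
Proof.
move=> sF i j; under eq_fun do under eq_fun do rewrite mxE.
exact: (smooth2_Dt (sF i j)).
Qed.

Lemma mxDx_cst (A : 'M[C]_(m, n)) x t : mxDx (fun _ _ => A) x t = 0.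
Proof. by apply/matrixP => i j; rewrite !mxE; exact: cderive_cst. Qed.

Lemma mxDt_cst (A : 'M[C]_(m, n)) x t : mxDt (fun _ _ => A) x t = 0.
Proof. by apply/matrixP => i j; rewrite !mxE; exact: cderive_cst. Qed.

Lemma mxDxD F G x t : mxsmooth F -> mxsmooth G ->
  mxDx (fun x t => F x t + G x t) x t = mxDx F x t + mxDx G x t.
Proof.
move=> sF sG; apply/matrixP => i j; rewrite !mxE.
under eq_fun do under eq_fun do rewrite mxE.
exact: (cderiveD (smooth2_cderivable_x x t (sF i j))
                 (smooth2_cderivable_x x t (sG i j))).
Qed.

Lemma mxDtD F G x t : mxsmooth F -> mxsmooth G ->
  mxDt (fun x t => F x t + G x t) x t = mxDt F x t + mxDt G x t.
Proof.
move=> sF sG; apply/matrixP => i j; rewrite !mxE.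
under eq_fun do under eq_fun do rewrite mxE.
exact: (cderiveD (smooth2_cderivable_t x t (sF i j))
                 (smooth2_cderivable_t x t (sG i j))).
Qed.

Lemma mxDxZ (c : C) F x t : mxsmooth F ->
  mxDx (fun x t => c *: F x t) x t = c *: mxDx F x t.
Proof.
move=> sF; apply/matrixP => i j; rewrite !mxE.
under eq_fun do under eq_fun do rewrite mxE.
exact: (cderiveZ c (smooth2_cderivable_x x t (sF i j))).
Qed.

Lemma mxDtZ (c : C) F x t : mxsmooth F ->
  mxDt (fun x t => c *: F x t) x t = c *: mxDt F x t.
Proof.
move=> sF; apply/matrixP => i j; rewrite !mxE.
under eq_fun do under eq_fun do rewrite mxE.
exact: (cderiveZ c (smooth2_cderivable_t x t (sF i j))).
Qed.

Lemma mxsmoothN F : mxsmooth F -> mxsmooth (fun x t => - F x t).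
Proof.
by move=> sF; under eq_fun do under eq_fun do rewrite -scaleN1r; exact: mxsmoothZ.
Qed.

Lemma mxDxN F x t : mxsmooth F -> mxDx (fun x t => - F x t) x t = - mxDx F x t.
Proof.
move=> sF; under eq_fun do under eq_fun do rewrite -scaleN1r.
by rewrite (mxDxZ _ _ _ sF) scaleN1r.
Qed.

Lemma mxsmooth_scale_cst (f : R -> R -> C) (A : 'M[C]_(m, n)) :
  smooth2 f -> mxsmooth (fun x t => f x t *: A).
Proof.
move=> sf i j; under eq_fun do under eq_fun do rewrite mxE.
exact: (smooth2M sf (smooth2_cst (A i j))).
Qed.

Lemma mxDx_scale_cst (f : R -> R -> C) (A : 'M[C]_(m, n)) x t :
  smooth2 f -> mxDx (fun x t => f x t *: A) x t = Dx f x t *: A.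
Proof.
move=> sf; apply/matrixP => i j; rewrite [LHS]mxE [RHS]mxE.
under eq_fun do under eq_fun do rewrite mxE.
rewrite /Dx (cderiveM (smooth2_cderivable_x x t sf) (cderivable_cst (A i j) x)).
by rewrite cderive_cst mulr0 addr0.
Qed.

Lemma mxDt_scale_cst (f : R -> R -> C) (A : 'M[C]_(m, n)) x t :
  smooth2 f -> mxDt (fun x t => f x t *: A) x t = Dt f x t *: A.
Proof.
move=> sf; apply/matrixP => i j; rewrite [LHS]mxE [RHS]mxE.
under eq_fun do under eq_fun do rewrite mxE.
rewrite /Dt (cderiveM (smooth2_cderivable_t x t sf) (cderivable_cst (A i j) t)).
by rewrite cderive_cst mulr0 addr0.
Qed.

Lemma mxDt_Dx F x t : mxsmooth F -> mxDt (mxDx F) x t = mxDx (mxDt F) x t.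
Proof.
move=> sF; apply/matrixP => i j; rewrite [LHS]mxE [RHS]mxE.
have -> : (fun y s => mxDx F y s i j) = Dx (fun y s => F y s i j).
  by apply/funext => y; apply/funext => s; rewrite mxE.
have -> : (fun y s => mxDt F y s i j) = Dt (fun y s => F y s i j).
  by apply/funext => y; apply/funext => s; rewrite mxE.
exact: (Dt_Dx x t (sF i j)).
Qed.

End Smoothness.

Section Product.
Variables (m n p : nat).
Implicit Types (F : R -> R -> 'M[C]_(m, n)) (G : R -> R -> 'M[C]_(n, p)).

Lemma mxsmoothM F G : mxsmooth F -> mxsmooth G -> mxsmooth (fun x t => F x t *m G x t).
Proof.
move=> sF sG i j; under eq_fun do under eq_fun do rewrite mxE.
by apply: smooth2_sum => k; exact: (smooth2M (sF i k) (sG k j)).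
Qed.

Lemma mxDxM F G x t : mxsmooth F -> mxsmooth G ->
  mxDx (fun x t => F x t *m G x t) x t = mxDx F x t *m G x t + F x t *m mxDx G x t.
Proof.
move=> sF sG; apply/matrixP => i j; rewrite !mxE.
under eq_fun do under eq_fun do rewrite mxE.
rewrite /Dx (cderive_sum (index_enum 'I_n) (F := fun k y => F y t i k * G y t k j)).
  rewrite -big_split /=; apply: eq_bigr => k _; rewrite !mxE.
  exact: (cderiveM (smooth2_cderivable_x x t (sF i k))
                   (smooth2_cderivable_x x t (sG k j))).
move=> k; exact: (cderivableM (smooth2_cderivable_x x t (sF i k))
                   (smooth2_cderivable_x x t (sG k j))).
Qed.

Lemma mxDtM F G x t : mxsmooth F -> mxsmooth G ->
  mxDt (fun x t => F x t *m G x t) x t = mxDt F x t *m G x t + F x t *m mxDt G x t.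
Proof.
move=> sF sG; apply/matrixP => i j; rewrite !mxE.
under eq_fun do under eq_fun do rewrite mxE.
rewrite /Dt (cderive_sum (index_enum 'I_n) (F := fun k s => F x s i k * G x s k j)).
  rewrite -big_split /=; apply: eq_bigr => k _; rewrite !mxE.
  exact: (cderiveM (smooth2_cderivable_t x t (sF i k))
                   (smooth2_cderivable_t x t (sG k j))).
move=> k; exact: (cderivableM (smooth2_cderivable_t x t (sF i k))
                   (smooth2_cderivable_t x t (sG k j))).
Qed.

End Product.

Lemma mxsmooth_mxcomm n (F G : R -> R -> 'M[C]_n) : mxsmooth F -> mxsmooth G ->
  mxsmooth (fun x t => mxcomm (F x t) (G x t)).
Proof.
by move=> sF sG; exact: (mxsmoothD (mxsmoothM sF sG) (mxsmoothN (mxsmoothM sG sF))).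
Qed.

Lemma mxDx_mxcomm n (F G : R -> R -> 'M[C]_n) x t : mxsmooth F -> mxsmooth G ->
  mxDx (fun x t => mxcomm (F x t) (G x t)) x t =
  mxcomm (mxDx F x t) (G x t) + mxcomm (F x t) (mxDx G x t).
Proof.
move=> sF sG; rewrite /mxcomm.
rewrite (mxDxD _ _ (mxsmoothM sF sG) (mxsmoothN (mxsmoothM sG sF))).
rewrite (mxDxN _ _ (mxsmoothM sG sF)) (mxDxM _ _ sF sG) (mxDxM _ _ sG sF).
by rewrite opprD [- (mxDx G x t *m F x t) - _]addrC addrACA.
Qed.

Lemma commutator_first_order n (U V : R -> R -> 'M[C]_n)
    (psi : R -> R -> 'cV[C]_n) x t :
  mxsmooth U -> mxsmooth V -> mxsmooth psi ->
  let L phi := fun x t => 'i *: mxDx phi x t + U x t *m phi x t in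
  let M phi := fun x t => 'i *: mxDt phi x t + V x t *m phi x t in
  L (M psi) x t - M (L psi) x t =
    ('i *: mxDx V x t - 'i *: mxDt U x t + mxcomm (U x t) (V x t)) *m psi x t.
Proof.
move=> sU sV sp L M; rewrite /L /M.
have sx := mxsmooth_Dx sp; have st := mxsmooth_Dt sp.
rewrite (mxDxD _ _ (mxsmoothZ 'i st) (mxsmoothM sV sp)) (mxDxZ _ _ _ st).
rewrite (mxDtD _ _ (mxsmoothZ 'i sx) (mxsmoothM sU sp)) (mxDtZ _ _ _ sx).
rewrite (mxDxM _ _ sV sp) (mxDtM _ _ sU sp) (mxDt_Dx _ _ sp).
exact: commutator_zero_order.
Qed.
End MatrixCalculus.

(** * Zero-curvature equation *)

Section BlockAlgebra.
Variable C : fieldType.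
Local Notation M3 := 'M[C]_3.

Lemma mul_block3 (A11 A12 A13 A21 A22 A23 A31 A32 A33 : M3)
    (B11 B12 B13 B21 B22 B23 B31 B32 B33 : M3) :
  block3 A11 A12 A13 A21 A22 A23 A31 A32 A33 *m
  block3 B11 B12 B13 B21 B22 B23 B31 B32 B33 =
  block3
   (A11 *m B11 + (A12 *m B21 + A13 *m B31)) (A11 *m B12 + (A12 *m B22 + A13 *m B32))
   (A11 *m B13 + (A12 *m B23 + A13 *m B33))
   (A21 *m B11 + (A22 *m B21 + A23 *m B31)) (A21 *m B12 + (A22 *m B22 + A23 *m B32))
   (A21 *m B13 + (A22 *m B23 + A23 *m B33))
   (A31 *m B11 + (A32 *m B21 + A33 *m B31)) (A31 *m B12 + (A32 *m B22 + A33 *m B32))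
   (A31 *m B13 + (A32 *m B23 + A33 *m B33)).
Proof.
rewrite /block3 mulmx_block mul_row_col mul_mx_row mul_row_block add_row_mx.
rewrite mul_col_mx mul_block_col add_col_mx mul_col_row mulmx_block add_block_mx.
by [].
Qed.

Lemma add_block3 (A11 A12 A13 A21 A22 A23 A31 A32 A33 : M3)
    (B11 B12 B13 B21 B22 B23 B31 B32 B33 : M3) :
  block3 A11 A12 A13 A21 A22 A23 A31 A32 A33 +
  block3 B11 B12 B13 B21 B22 B23 B31 B32 B33 =
  block3 (A11 + B11) (A12 + B12) (A13 + B13) (A21 + B21) (A22 + B22) (A23 + B23)
    (A31 + B31) (A32 + B32) (A33 + B33).
Proof. by rewrite /block3 add_block_mx add_row_mx add_col_mx add_block_mx. Qed.

Lemma opp_block3 (A11 A12 A13 A21 A22 A23 A31 A32 A33 : M3) :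
  - block3 A11 A12 A13 A21 A22 A23 A31 A32 A33 =
  block3 (- A11) (- A12) (- A13) (- A21) (- A22) (- A23) (- A31) (- A32) (- A33).
Proof. by rewrite /block3 opp_block_mx opp_row_mx opp_col_mx opp_block_mx. Qed.

Lemma scale_block3 (c : C) (A11 A12 A13 A21 A22 A23 A31 A32 A33 : M3) :
  c *: block3 A11 A12 A13 A21 A22 A23 A31 A32 A33 =
  block3 (c *: A11) (c *: A12) (c *: A13) (c *: A21) (c *: A22) (c *: A23)
    (c *: A31) (c *: A32) (c *: A33).
Proof. by rewrite /block3 scale_block_mx scale_row_mx scale_col_mx scale_block_mx. Qed.

Lemma block3_0 : block3 0 0 0 0 0 0 0 0 0 = 0 :> 'M[C]_(3 + (3 + 3)).
Proof. by rewrite /block3 row_mx0 col_mx0 !block_mx0. Qed.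

Lemma block3_inj (A11 A12 A13 A21 A22 A23 A31 A32 A33 : M3)
    (B11 B12 B13 B21 B22 B23 B31 B32 B33 : M3) :
  block3 A11 A12 A13 A21 A22 A23 A31 A32 A33 =
  block3 B11 B12 B13 B21 B22 B23 B31 B32 B33 ->
  [/\ A11 = B11, A12 = B12 & A13 = B13] /\ [/\ A21 = B21, A22 = B22 & A23 = B23] /\
  [/\ A31 = B31, A32 = B32 & A33 = B33].
Proof.
move=> /eq_block_mx [-> /eq_row_mx [-> ->] /eq_col_mx [-> ->]
  /eq_block_mx [-> -> -> ->]].
by [].

Qed.

Lemma eq_block3 (A11 A12 A13 A21 A22 A23 A31 A32 A33 : M3)
    (B11 B12 B13 B21 B22 B23 B31 B32 B33 : M3) :
  A11 = B11 -> A12 = B12 -> A13 = B13 -> A21 = B21 -> A22 = B22 -> A23 = B23 ->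
  A31 = B31 -> A32 = B32 -> A33 = B33 ->
  block3 A11 A12 A13 A21 A22 A23 A31 A32 A33 =
  block3 B11 B12 B13 B21 B22 B23 B31 B32 B33.
Proof. by move=> -> -> -> -> -> -> -> -> ->. Qed.

(** The part of degree 1 and -1 in the grading by eigenvalues of the commutator with [J]. Block
    diagonal matrices have degree 0, and the corner blocks have degree 2 and -2. *)
Definition off_block (q p q' p' : M3) : 'M[C]_(3 + (3 + 3)) :=
  block3 0 q 0 p 0 q' 0 p' 0.

Lemma mul_off_block (q p q' p' a b a' b' : M3) :
  off_block q p q' p' *m off_block a b a' b' =
  block3 (q *m b) 0 (q *m a') 0 (p *m a + q' *m b') 0 (p' *m b) 0 (p' *m a').
Proof. by rewrite mul_block3 !(mul0mx, mulmx0, addr0, add0r). Qed.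

Lemma mxcomm_off_block_diag (q p q' p' A B D : M3) :
  mxcomm (off_block q p q' p') (block3 A 0 0 0 B 0 0 0 D) =
  off_block (q *m B - A *m q) (p *m A - B *m p) (q' *m D - B *m q') (p' *m B - D *m p').
Proof.
rewrite /mxcomm !mul_block3 opp_block3 add_block3.
by rewrite !(mul0mx, mulmx0, addr0, add0r, subr0, oppr0).
Qed.

Lemma s1_involutive : s1 C *m s1 C = 1%:M.
Proof.
apply/matrixP => i j.
case: i => [[|[|[|//]]] ?]; case: j => [[|[|[|//]]] ?];
rewrite !(mxE, big_ord_recl, big_ord0) /=; ring.
Qed.

Lemma tr_s1 : (s1 C)^T = s1 C.
Proof.
apply/matrixP => i j.
by case: i => [[|[|[|//]]] ?]; case: j => [[|[|[|//]]] ?]; rewrite !mxE.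
Qed.

Lemma tildeK : involutive (@tilde C).
Proof.
move=> q; rewrite /tilde !trmx_mul trmxK tr_s1 !mulmxA s1_involutive mul1mx.
by rewrite -mulmxA s1_involutive mulmx1.
Qed.

Lemma tildeD (a b : M3) : tilde (a + b) = tilde a + tilde b.
Proof. by rewrite /tilde linearD mulmxDr mulmxDl. Qed.

Lemma tildeN (a : M3) : tilde (- a) = - tilde a.
Proof. by rewrite /tilde linearN mulmxN mulNmx. Qed.

Lemma tildeZ (c : C) (a : M3) : tilde (c *: a) = c *: tilde a.
Proof. by rewrite /tilde linearZ /= -scalemxAr -scalemxAl. Qed.

Lemma tilde0 : tilde 0 = 0 :> M3.
Proof. by rewrite /tilde linear0 mulmx0 mul0mx. Qed.

Lemma tildeM (a b : M3) : tilde (a *m b) = tilde b *m tilde a.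
Proof.
by rewrite /tilde trmx_mul !mulmxA -[_ *m s1 C *m s1 C]mulmxA s1_involutive mulmx1.
Qed.

Lemma tr_tilde_tr (a : M3) : (tilde a^T)^T = tilde a.
Proof.
by rewrite /tilde !trmx_mul trmxK tr_s1 mulmxA.
Qed.

(** The sum of the [lam] and [lam ^+ 2] terms is [lam] times [Q - lam *: J], so it commutes with the
    left argument and drops out. *)
Lemma mxcomm_spectral n (Q A J : 'M[C]_n) (lam : C) :
  mxcomm (Q - lam *: J) (A + lam *: Q - lam ^+ 2 *: J) =
  mxcomm Q A - lam *: mxcomm J A.
Proof.
rewrite /mxcomm !(mulmxDl, mulmxDr, mulNmx, mulmxN).
rewrite -!(scalemxAl, scalemxAr).
move: (Q *m A) (A *m Q) (J *m A) (A *m J) (Q *m J) (J *m Q) (Q *m Q) (J *m J).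
move=> a b c d e f g h; apply/matrixP => i j; rewrite !mxE; ring.
Qed.

(** Commutation with [J] multiplies the upper blocks by 1 and the lower ones by -1, which explains
    the signs in [potential1]. *)
Lemma mxcomm_J_off_block (q p q' p' : M3) :
  mxcomm (J C) (off_block q (- p) q' (- p')) = off_block q p q' p'.
Proof.
rewrite /mxcomm !mul_block3 opp_block3 add_block3.
by rewrite !(mul0mx, mulmx0, mul1mx, mulmx1, mulNmx, mulmxN, addr0, add0r, subr0,
  opprK, oppr0).
Qed.

Lemma mxcomm_J_diag (A B D : M3) : mxcomm (J C) (block3 A 0 0 0 B 0 0 0 D) = 0.
Proof.
rewrite /mxcomm !mul_block3 opp_block3 add_block3 -block3_0.
by rewrite !(mul0mx, mulmx0, mul1mx, mulmx1, mulNmx, mulmxN, addr0, add0r, subr0,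
  opprK, oppr0, subrr).
Qed.

Lemma mxcomm_linear_r n (Q A B : 'M[C]_n) (k : C) :
  mxcomm Q (k *: A + B) = k *: mxcomm Q A + mxcomm Q B.
Proof.
rewrite /mxcomm mulmxDr mulmxDl -scalemxAr -scalemxAl.
move: (Q *m A) (A *m Q) (Q *m B) (B *m Q) => a b c d.
apply/matrixP => i j; rewrite !mxE; ring.
Qed.

End BlockAlgebra.

(** * Rank-one blocks allowed by the reductions *)

Section ReducedMatrices.
Variable C : fieldType.
Local Notation M3 := 'M[C]_3.

Lemma mul_mx3 (a11 a12 a13 a21 a22 a23 a31 a32 a33 : C)
    (b11 b12 b13 b21 b22 b23 b31 b32 b33 : C) :
  mx3 [:: [:: a11; a12; a13]; [:: a21; a22; a23]; [:: a31; a32; a33]] *m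
  mx3 [:: [:: b11; b12; b13]; [:: b21; b22; b23]; [:: b31; b32; b33]] =
  mx3 [:: [:: a11 * b11 + (a12 * b21 + a13 * b31); a11 * b12 + (a12 * b22 + a13 * b32);
              a11 * b13 + (a12 * b23 + a13 * b33)];
          [:: a21 * b11 + (a22 * b21 + a23 * b31); a21 * b12 + (a22 * b22 + a23 * b32);
              a21 * b13 + (a22 * b23 + a23 * b33)];
          [:: a31 * b11 + (a32 * b21 + a33 * b31); a31 * b12 + (a32 * b22 + a33 * b32);
              a31 * b13 + (a32 * b23 + a33 * b33)]].
Proof.
apply/matrixP => i j; case: i => [[|[|[|//]]] ?]; case: j => [[|[|[|//]]] ?];
by rewrite !(mxE, big_ord_recl, big_ord0) /= addr0.
Qed.

Lemma tr_mx3 (a11 a12 a13 a21 a22 a23 a31 a32 a33 : C) :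
  (mx3 [:: [:: a11; a12; a13]; [:: a21; a22; a23]; [:: a31; a32; a33]])^T =
  mx3 [:: [:: a11; a21; a31]; [:: a12; a22; a32]; [:: a13; a23; a33]].
Proof.
by apply/matrixP => i j; case: i => [[|[|[|//]]] ?]; case: j => [[|[|[|//]]] ?];
rewrite !mxE.
Qed.

Lemma reduced_qD a b a' b' :
  reduced_q a b + reduced_q a' b' = reduced_q (a + a') (b + b') :> M3.
Proof.
by apply/matrixP => i j; case: i => [[|[|[|//]]] ?]; case: j => [[|[|[|//]]] ?];
rewrite !mxE /= ?opprD.
Qed.

Lemma reduced_qZ (c a b : C) : c *: reduced_q a b = reduced_q (c * a) (c * b).
Proof.
by apply/matrixP => i j; case: i => [[|[|[|//]]] ?]; case: j => [[|[|[|//]]] ?];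
rewrite !mxE /= ?mulrN.
Qed.

Lemma reduced_q_eq0 (a b : C) : reduced_q a b = 0 -> a = 0 /\ b = 0.
Proof.
by move=> /matrixP E; have := E 0 0; have := E 0 1; rewrite !mxE /= => -> ->.
Qed.

Lemma tilde_reduced_q (a b : C) : tilde (reduced_q a b) =
  mx3 [:: [:: - a; - a; - a]; [:: - b; - b; - b]; [:: a; a; a]].
Proof.
rewrite /tilde tr_mx3 !mul_mx3; congr mx3; do 3?congr cons; do 3?congr cons; ring.
Qed.

Lemma tilde_tr_reduced_q (a b : C) : tilde (reduced_q a b)^T =
  mx3 [:: [:: - a; - b; a]; [:: - a; - b; a]; [:: - a; - b; a]].
Proof.
rewrite /tilde tr_mx3 tr_mx3 !mul_mx3; congr mx3; do 3?congr cons; do 3?congr cons; ring.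
Qed.

(** Writing the two matrices as u r^T and u r'^T, the left side is u (r^T s1 r') (s1 u)^T, and the
    middle scalar is symmetric in r and r' because [s1] is. The same scalar governs the transposed
    version below. *)
Lemma reduced_tilde_sym (a b a' b' : C) :
  reduced_q a b *m tilde (reduced_q a' b') = reduced_q a' b' *m tilde (reduced_q a b).
Proof.
rewrite !tilde_reduced_q !mul_mx3; congr mx3; do 3?congr cons; do 3?congr cons; ring.
Qed.

Lemma reduced_tr_tilde_sym (a b a' b' : C) :
  tilde (reduced_q a b)^T *m (reduced_q a' b')^T =
  tilde (reduced_q a' b')^T *m (reduced_q a b)^T.
Proof.
rewrite !tilde_tr_reduced_q !tr_mx3 !mul_mx3.
congr mx3; do 3?congr cons; do 3?congr cons; ring.
Qed.

(** With q = u r^T and p = r' u^T, q p q = 3 (r^T r') q, where 3 = u^T u and r^T r' = 2 q1 p1 + q2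
    p2. Since s1 r' = - r' and r^T s1 r = - (2 q1^2 + q2^2), the other term q ~q ~p is 3 (2 q1^2 +
    q2^2) u r'^T. *)
Lemma reduced_cubic (q1 q2 p1 p2 : C) :
  let q := reduced_q q1 q2 in let p := (reduced_q p1 p2)^T in
  2%:R *: (q *m p *m q) - q *m tilde q *m tilde p =
  reduced_q (6 * (q1 * p1 + q2 * p2) * q1 - 3 * q2 ^+ 2 * p1)
            (3 * (4 * (q1 * p1) + q2 * p2) * q2 - 6 * q1 ^+ 2 * p2).
Proof.
rewrite /= tilde_reduced_q tilde_tr_reduced_q tr_mx3 !mul_mx3.
apply/matrixP => i j; case: i => [[|[|[|//]]] ?]; case: j => [[|[|[|//]]] ?];
rewrite !mxE /=; ring.
Qed.

End ReducedMatrices.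

(** Final bookkeeping of the zero-curvature equation: [A], [W], [X], [B], [D] stand for Q1_xx, the
    x-derivative of V2, Q_x, Q_t and [Q, V2]. The [lam] terms cancel, as do the two copies of
    [W]. *)
Lemma spectral_cancel (C : comNzRingType) m n (k lam : C) (A W X B D : 'M[C]_(m, n)) :
  k * k = -1 ->
  k *: (k *: A + W + lam *: X) - k *: B + (k *: - W + D - lam *: (k *: X + 0)) =
  - A - k *: B + D.
Proof.
move=> kk; apply/matrixP => i j; rewrite !mxE.
rewrite -[- A i j]mulN1r -kk; ring.
Qed.

Section ZeroCurvature.
Variable C : fieldType.
Local Notation M3 := 'M[C]_3.
Implicit Types (q p : M3).

(** The products Q1 Q and Q Q1 agree in the corner blocks and are opposite in the diagonal ones. The
    result has degree 0, hence commutes with [J]. *)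
Lemma half_mxcomm_potential q p : (2 : C) != 0 ->
  2^-1 *: mxcomm (potential1 q p) (potential q p) =
  block3 (q *m p) 0 0 0 (tilde q *m tilde p - p *m q) 0 0 0 (- (tilde p *m tilde q)).
Proof.
move=> n2; have h2 : (2^-1 : C) * 2 = 1 by rewrite mulVf.
rewrite /mxcomm /potential /potential1 -!/(off_block _ _ _ _) !mul_off_block.
rewrite !(opp_block3, add_block3, scale_block3) !(mulNmx, mulmxN).
apply: eq_block3; apply/matrixP => i j; rewrite !mxE ?(addr0, mulr0, subrr)//;
  apply: (mulfI n2); rewrite mulrA [2 * 2^-1]mulrC h2 mul1r; ring.
Qed.

(** The derivative of V2 plus [Q, Q1_x] vanishes: the diagonal blocks cancel identically, and the
    (1,3) and (3,1) corners reduce to the two symmetry hypotheses. *)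
Lemma mxcomm_potential_derivative q p qx px : (2 : C) != 0 ->
  q *m tilde qx = qx *m tilde q -> tilde p *m px = tilde px *m p ->
  2^-1 *: (mxcomm (potential1 qx px) (potential q p)
           + mxcomm (potential1 q p) (potential qx px))
  + mxcomm (potential q p) (potential1 qx px) = 0.
Proof.
move=> n2 Eq Ep; have h2 : (2^-1 : C) * 2 = 1 by rewrite mulVf.
rewrite /mxcomm /potential /potential1 -!/(off_block _ _ _ _) !mul_off_block.
rewrite !(opp_block3, add_block3, scale_block3) -block3_0.
rewrite !(mulNmx, mulmxN) Eq Ep.
apply: eq_block3; apply/matrixP => i j; rewrite !mxE ?(addr0, mulr0, subrr)//;
  apply: (mulfI n2); rewrite mulr0 mulrDr mulrA [2 * 2^-1]mulrC h2 mul1r; ring.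
Qed.

(* Up to sign, the upper off-diagonal blocks of the zero-curvature equation. *)
Definition nls_residual (k : C) (q p qt qxx : M3) : M3 :=
  k *: qt + qxx + (2 *: (q *m p *m q) - q *m tilde q *m tilde p).

(** Transposition reverses products and thereby exchanges the roles of q and p, so the lower blocks
    need no residual of their own. *)
Lemma tr_nls_residual (k : C) q p pt pxx :
  (nls_residual k p^T q^T pt^T pxx^T)^T =
  k *: pt + pxx + (2 *: (p *m q *m p) - tilde q *m tilde p *m p).
Proof.
have trD (a b : M3) : (a + b)^T = a^T + b^T by apply/matrixP => i j; rewrite !mxE.
have trN (a : M3) : (- a)^T = - a^T by apply/matrixP => i j; rewrite !mxE.
have trZ c (a : M3) : (c *: a)^T = c *: a^T by apply/matrixP => i j; rewrite !mxE.
rewrite /nls_residual !(trD, trN, trZ).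
rewrite [(p^T *m tilde _ *m _)^T]trmx_mul [(p^T *m tilde _)^T]trmx_mul.
rewrite [(p^T *m q^T *m p^T)^T]trmx_mul [(p^T *m q^T)^T]trmx_mul.
by rewrite !trmxK !tr_tilde_tr !mulmxA.
Qed.

(** Since [tilde] is an involution that reverses products, the (2,3) block carries the same equation
    as the (1,2) block. *)
Lemma tilde_nls_residual (k : C) q p qt qxx :
  tilde (nls_residual k q p qt qxx) = k *: tilde qt + tilde qxx
  + (2 *: (tilde q *m tilde p *m tilde q) - p *m q *m tilde q).
Proof.
rewrite /nls_residual !(tildeD, tildeN, tildeZ).
rewrite [tilde (q *m tilde q *m tilde p)]tildeM [tilde (q *m tilde q)]tildeM.
rewrite [tilde (q *m p *m q)]tildeM [tilde (q *m p)]tildeM.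
by rewrite !tildeK !mulmxA.
Qed.

(** The letter [k] stands for the imaginary unit; only its square is used. The lower blocks come
    with [- k] because [potential1] negates p, reversing the sign of the second derivative relative
    to the time derivative. *)
Lemma zero_curvature (k lam : C) q p qx px qxx pxx qt pt :
  (2 : C) != 0 -> k * k = -1 ->
  q *m tilde qx = qx *m tilde q -> tilde p *m px = tilde px *m p ->
  k *: (k *: potential1 qxx pxx
        + 2^-1 *: (mxcomm (potential1 qx px) (potential q p)
                   + mxcomm (potential1 q p) (potential qx px))
        + lam *: potential qx px)
  - k *: potential qt pt
  + mxcomm (potential q p - lam *: J C)
      (k *: potential1 qx px + 2^-1 *: mxcomm (potential1 q p) (potential q p)
       + lam *: potential q p - lam ^+ 2 *: J C) =
  let E := nls_residual k q p qt qxx in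
  let F := (nls_residual (- k) p^T q^T pt^T pxx^T)^T in
  off_block (- E) F (- tilde E) (tilde F).
Proof.
move=> n2 kk Eq Ep /=.
rewrite mxcomm_spectral half_mxcomm_potential// !mxcomm_linear_r mxcomm_J_diag.
rewrite mxcomm_J_off_block -/(off_block _ _ _ _) -/(potential qx px).
have := mxcomm_potential_derivative n2 Eq Ep.
set W := 2^-1 *: _; set A := mxcomm _ (potential1 qx px) => WA.
have {WA} -> : A = - W by apply/eqP; rewrite -addr_eq0 addrC WA.
rewrite /potential /potential1 -!/(off_block _ _ _ _) mxcomm_off_block_diag.
rewrite (spectral_cancel _ _ _ _ _ _ kk).
rewrite /off_block !(opp_block3, scale_block3, add_block3).
rewrite tr_nls_residual tilde_nls_residual /nls_residual.
rewrite !(tildeD, tildeN, tildeZ).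
rewrite [tilde (p *m q *m p)]tildeM [tilde (p *m q)]tildeM.
rewrite [tilde (tilde q *m tilde p *m p)]tildeM [tilde (tilde q *m tilde p)]tildeM.
rewrite !tildeK.
rewrite !(mulmxBr, mulmxBl, mulmxN, mulNmx, mulmxA).
by apply: eq_block3; do ?[move: (_ *m _ *m _) => ?]; apply/matrixP => i j;
  rewrite !mxE; ring.
Qed.

Lemma nls_residual_reduced (k q1 q2 p1 p2 q1t q2t q1xx q2xx : C) :
  nls_residual k (reduced_q q1 q2) (reduced_q p1 p2)^T (reduced_q q1t q2t)
    (reduced_q q1xx q2xx) =
  reduced_q (k * q1t + q1xx + 6 * (q1 * p1 + q2 * p2) * q1 - 3 * q2 ^+ 2 * p1)
    (k * q2t + q2xx + 3 * (4 * (q1 * p1) + q2 * p2) * q2 - 6 * q1 ^+ 2 * p2).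
Proof. by rewrite /nls_residual reduced_cubic reduced_qZ !reduced_qD !addrA. Qed.

Lemma potential_linear (a b c d : C) (X Y Z W : M3) :
  potential (a *: X + b *: Y) (c *: Z + d *: W) =
  a *: potential X 0 + (b *: potential Y 0 + (c *: potential 0 Z + d *: potential 0 W)).
Proof.
rewrite /potential !(scale_block3, add_block3) !(tildeD, tildeZ, tilde0).
by rewrite !(scaler0, addr0, add0r).
Qed.

Lemma potential1_linear (a b c d : C) (X Y Z W : M3) :
  potential1 (a *: X + b *: Y) (c *: Z + d *: W) =
  a *: potential1 X 0 + (b *: potential1 Y 0 + (c *: potential1 0 Z + d *: potential1 0 W)).
Proof.
rewrite /potential1 !(scale_block3, add_block3) !(tildeD, tildeZ, tilde0).
by rewrite !(oppr0, scaler0, addr0, add0r, opprD, scalerN).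
Qed.

Lemma reduced_q_linear (a b : C) :
  reduced_q a b = a *: reduced_q 1 0 + b *: reduced_q 0 1.
Proof. by rewrite !reduced_qZ reduced_qD !mulr1 !mulr0 addr0 add0r. Qed.

Lemma tr_reduced_q_linear (a b : C) :
  (reduced_q a b)^T = a *: (reduced_q 1 0)^T + b *: (reduced_q 0 1)^T.
Proof. by rewrite reduced_q_linear; apply/matrixP => i j; rewrite !mxE. Qed.

End ZeroCurvature.

(** * Lax pair of the reduced potential *)

Section LaxPair.
Variable R : realType.
Local Notation C := R[i].
Local Notation M9 := 'M[C]_(3 + (3 + 3)).

Section Linear.
Variables (m n : nat) (P : C -> C -> C -> C -> 'M[C]_(m, n)).
Hypothesis P_linear : forall a b c d, P a b c d =
  a *: P 1 0 0 0 + (b *: P 0 1 0 0 + (c *: P 0 0 1 0 + d *: P 0 0 0 1)).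
Variables a b c d : R -> R -> C.
Hypotheses (sa : smooth2 a) (sb : smooth2 b) (sc : smooth2 c) (sd : smooth2 d).

Let P_linear_fun : (fun x t => P (a x t) (b x t) (c x t) (d x t)) =
  (fun x t => a x t *: P 1 0 0 0 + (b x t *: P 0 1 0 0 +
              (c x t *: P 0 0 1 0 + d x t *: P 0 0 0 1))).
Proof. by apply/funext => x; apply/funext => t; exact: P_linear. Qed.

Let scd := mxsmoothD (mxsmooth_scale_cst (P 0 0 1 0) sc) (mxsmooth_scale_cst (P 0 0 0 1) sd).
Let sbcd := mxsmoothD (mxsmooth_scale_cst (P 0 1 0 0) sb) scd.

(** A map linear in four scalars is a sum of constant matrices weighted by scalar fields, so
    smoothness and derivatives pass to its arguments without inspecting entries. It is applied to
    [rpotential] and [rpotential1]. *)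
Lemma mxsmooth_linear : mxsmooth (fun x t => P (a x t) (b x t) (c x t) (d x t)).
Proof.
by rewrite P_linear_fun; exact: (mxsmoothD (mxsmooth_scale_cst (P 1 0 0 0) sa) sbcd).
Qed.

Lemma mxDx_linear x t : mxDx (fun x t => P (a x t) (b x t) (c x t) (d x t)) x t =
  P (Dx a x t) (Dx b x t) (Dx c x t) (Dx d x t).
Proof.
rewrite P_linear_fun (mxDxD _ _ (mxsmooth_scale_cst _ sa) sbcd).
rewrite (mxDxD _ _ (mxsmooth_scale_cst _ sb) scd).
rewrite (mxDxD _ _ (mxsmooth_scale_cst _ sc) (mxsmooth_scale_cst _ sd)).
rewrite (mxDx_scale_cst _ _ _ sa) (mxDx_scale_cst _ _ _ sb).
rewrite (mxDx_scale_cst _ _ _ sc) (mxDx_scale_cst _ _ _ sd).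
by rewrite -P_linear.
Qed.

Lemma mxDt_linear x t : mxDt (fun x t => P (a x t) (b x t) (c x t) (d x t)) x t =
  P (Dt a x t) (Dt b x t) (Dt c x t) (Dt d x t).
Proof.
rewrite P_linear_fun (mxDtD _ _ (mxsmooth_scale_cst _ sa) sbcd).
rewrite (mxDtD _ _ (mxsmooth_scale_cst _ sb) scd).
rewrite (mxDtD _ _ (mxsmooth_scale_cst _ sc) (mxsmooth_scale_cst _ sd)).
rewrite (mxDt_scale_cst _ _ _ sa) (mxDt_scale_cst _ _ _ sb).
rewrite (mxDt_scale_cst _ _ _ sc) (mxDt_scale_cst _ _ _ sd).
by rewrite -P_linear.
Qed.

End Linear.

Definition rpotential (F : fieldType) (a b c d : F) :=
  potential (reduced_q a b) (reduced_q c d)^T.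

Definition rpotential1 (F : fieldType) (a b c d : F) :=
  potential1 (reduced_q a b) (reduced_q c d)^T.

Lemma reduced_q0 (F : fieldType) : reduced_q 0 0 = 0 :> 'M[F]_3.
Proof. by rewrite reduced_q_linear !scale0r addr0. Qed.

Lemma rpotential_linear (F : fieldType) (a b c d : F) : rpotential a b c d =
  a *: rpotential 1 0 0 0 + (b *: rpotential 0 1 0 0 +
  (c *: rpotential 0 0 1 0 + d *: rpotential 0 0 0 1)).
Proof.
rewrite /rpotential reduced_q_linear tr_reduced_q_linear potential_linear.
by rewrite reduced_q0 trmx0.
Qed.

Lemma rpotential1_linear (F : fieldType) (a b c d : F) : rpotential1 a b c d =
  a *: rpotential1 1 0 0 0 + (b *: rpotential1 0 1 0 0 +
  (c *: rpotential1 0 0 1 0 + d *: rpotential1 0 0 0 1)).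
Proof.
rewrite /rpotential1 reduced_q_linear tr_reduced_q_linear potential1_linear.
by rewrite reduced_q0 trmx0.
Qed.

Variables a b c d : R -> R -> C.
Hypotheses (sa : smooth2 a) (sb : smooth2 b) (sc : smooth2 c) (sd : smooth2 d).
Let Q x t := rpotential (a x t) (b x t) (c x t) (d x t).
Let Q1 x t := rpotential1 (a x t) (b x t) (c x t) (d x t).

(** The fields [c], [d] of the lower blocks are independent of [a], [b], and the resulting matrix
    does not contain [lam]. *)
Lemma lax_commutator (lam : C) (psi : R -> R -> 'cV[C]_(3 + (3 + 3))) x t :
  mxsmooth psi ->
  lax_L Q lam (lax_M Q Q1 lam psi) x t - lax_M Q Q1 lam (lax_L Q lam psi) x t =
  (let E := nls_residual 'i (reduced_q (a x t) (b x t)) (reduced_q (c x t) (d x t))^T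
     (reduced_q (Dt a x t) (Dt b x t)) (reduced_q (Dx (Dx a) x t) (Dx (Dx b) x t)) in
  let F := (nls_residual (- 'i) (reduced_q (c x t) (d x t)) (reduced_q (a x t) (b x t))^T
     (reduced_q (Dt c x t) (Dt d x t)) (reduced_q (Dx (Dx c) x t) (Dx (Dx d) x t)))^T in
  off_block (- E) F (- tilde E) (tilde F)) *m psi x t.
Proof.
move=> sp.
have sQ : mxsmooth Q := mxsmooth_linear (@rpotential_linear C) sa sb sc sd.
have sQ1 : mxsmooth Q1 := mxsmooth_linear (@rpotential1_linear C) sa sb sc sd.
have sU : mxsmooth (fun x t => Q x t - lam *: J C).
  exact: (mxsmoothD sQ (mxsmooth_cst (- (lam *: J C)))).
have sQ1x := mxsmooth_Dx sQ1.
have sV2 := mxsmoothZ 2^-1 (mxsmooth_mxcomm sQ1 sQ).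
have sJ := mxsmooth_cst (- (lam ^+ 2 *: J C)).
have s12 := mxsmoothD (mxsmoothZ 'i sQ1x) sV2.
have s123 := mxsmoothD s12 (mxsmoothZ lam sQ).
have sV := mxsmoothD s123 sJ.
rewrite (commutator_first_order x t sU sV sp); congr (_ *m _).
rewrite (mxDxD _ _ s123 sJ) (mxDxD _ _ s12 (mxsmoothZ lam sQ)).
rewrite (mxDxD _ _ (mxsmoothZ 'i sQ1x) sV2) (mxDxZ _ _ _ sQ1x) (mxDxZ _ _ _ sQ).
rewrite (mxDxZ _ _ _ (mxsmooth_mxcomm sQ1 sQ)) (mxDx_mxcomm _ _ sQ1 sQ).
rewrite (mxDtD _ _ sQ (mxsmooth_cst (- (lam *: J C)))) mxDt_cst mxDx_cst !addr0.
have Qx : mxDx Q = (fun x t => rpotential (Dx a x t) (Dx b x t) (Dx c x t) (Dx d x t)).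
  apply/funext => y; apply/funext => s.
  exact: (mxDx_linear (@rpotential_linear C) sa sb sc sd).
have Q1xE : mxDx Q1 = (fun x t => rpotential1 (Dx a x t) (Dx b x t) (Dx c x t) (Dx d x t)).
  apply/funext => y; apply/funext => s.
  exact: (mxDx_linear (@rpotential1_linear C) sa sb sc sd).
rewrite Q1xE Qx.
rewrite (mxDx_linear (@rpotential1_linear C) (smooth2_Dx sa) (smooth2_Dx sb)
  (smooth2_Dx sc) (smooth2_Dx sd)).
rewrite (mxDt_linear (@rpotential_linear C) sa sb sc sd).
rewrite /Q /Q1 /rpotential /rpotential1.
have n2 : (2 : C) != 0 by rewrite pnatr_eq0.
have ii : 'i * 'i = -1 :> C by rewrite -expr2 sqrCi.
have := zero_curvature lam (reduced_q (Dx (Dx a) x t) (Dx (Dx b) x t))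
  (reduced_q (Dx (Dx c) x t) (Dx (Dx d) x t))^T
  (reduced_q (Dt a x t) (Dt b x t)) (reduced_q (Dt c x t) (Dt d x t))^T n2 ii
  (reduced_tilde_sym (a x t) (b x t) (Dx a x t) (Dx b x t))
  (reduced_tr_tilde_sym (c x t) (d x t) (Dx c x t) (Dx d x t)).
by rewrite /= !trmxK.
Qed.

Lemma mulmx_cV_eq0 n (A : 'M[C]_n) : (forall v : 'cV[C]_n, A *m v = 0) -> A = 0.
Proof.
move=> A0; apply/matrixP => i j.
have /matrixP/(_ i 0) := A0 (delta_mx j 0).
by rewrite -colE !mxE.
Qed.

Lemma lax_compatible_residual :
  lax_compatible Q Q1 <-> forall x t,
    nls_residual 'i (reduced_q (a x t) (b x t)) (reduced_q (c x t) (d x t))^T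
     (reduced_q (Dt a x t) (Dt b x t)) (reduced_q (Dx (Dx a) x t) (Dx (Dx b) x t)) = 0 /\
    nls_residual (- 'i) (reduced_q (c x t) (d x t)) (reduced_q (a x t) (b x t))^T
     (reduced_q (Dt c x t) (Dt d x t)) (reduced_q (Dx (Dx c) x t) (Dx (Dx d) x t)) = 0.
Proof.
split=> [lax x t|EF lam psi sp x t]; last first.
  rewrite (lax_commutator lam x t sp); have [-> ->] := EF x t.
  by rewrite /= trmx0 tilde0 oppr0 /off_block block3_0 mul0mx.
(* The commutator is multiplication by a matrix free of [lam]: the value 0 and constant vectors
   already force that matrix to vanish. *)
have : off_block _ _ _ _ = 0 := mulmx_cV_eq0 (fun v =>
  etrans (esym (lax_commutator 0 x t (mxsmooth_cst v))) (lax 0 _ (mxsmooth_cst v) x t)).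
rewrite /off_block -block3_0 => /block3_inj[[_ E0 _] [[F0 _ _] _]].
split; first by apply/eqP; rewrite -oppr_eq0 E0.
by apply: trmx_inj; rewrite F0 trmx0.
Qed.
End LaxPair.

(** * Conjugate lower blocks and the NLS system *)

Section ReducedLaxPair.
Variable R : realType.
Local Notation C := R[i].
Variables q1 q2 : R -> R -> C.
Hypotheses (s1 : smooth2 q1) (s2 : smooth2 q2).

Lemma Dx_conj (f : R -> R -> C) x t : smooth2 f ->
  Dx (fun x t => (f x t)^*) x t = (Dx f x t)^*.
Proof. by move=> sf; exact: (@cderive_conj R (f^~ t) x (smooth2_cderivable_x x t sf).2). Qed.

Lemma Dt_conj (f : R -> R -> C) x t : smooth2 f ->
  Dt (fun x t => (f x t)^*) x t = (Dt f x t)^*.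
Proof. by move=> sf; exact: (@cderive_conj R (f x) t (smooth2_cderivable_t x t sf).2). Qed.

Lemma Dxx_conj (f : R -> R -> C) x t : smooth2 f ->
  Dx (Dx (fun x t => (f x t)^*)) x t = (Dx (Dx f) x t)^*.
Proof.
move=> sf; rewrite -(Dx_conj x t (smooth2_Dx sf)); congr (Dx _ x t).
by apply/funext => y; apply/funext => s; exact: Dx_conj.
Qed.

Lemma nls_qE x t : nls_q q1 q2 x t <->
  nls_residual 'i (reduced_q (q1 x t) (q2 x t)) (reduced_q (q1 x t)^* (q2 x t)^*)^T
     (reduced_q (Dt q1 x t) (Dt q2 x t)) (reduced_q (Dx (Dx q1) x t) (Dx (Dx q2) x t)) = 0.
Proof.
rewrite nls_residual_reduced /nls_q (normCK (q1 x t)) (normCK (q2 x t)).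
by split=> [[E1 E2]|/reduced_q_eq0//]; rewrite E1 E2 reduced_q0.
Qed.

(** Conjugation sends 'i to - 'i and exchanges the fields with their conjugates, so the equation in
    the lower blocks follows from the one in the upper blocks. *)
Lemma nls_residual_conj (F : numClosedFieldType) (a b at' bt axx bxx : F) :
  nls_residual 'i (reduced_q a b) (reduced_q a^* b^*)^T (reduced_q at' bt)
    (reduced_q axx bxx) = 0 ->
  nls_residual (- 'i) (reduced_q a^* b^*) (reduced_q a b)^T (reduced_q at'^* bt^*)
    (reduced_q axx^* bxx^*) = 0.
Proof.
rewrite !nls_residual_reduced => /reduced_q_eq0[/(congr1 Num.conj) + /(congr1 Num.conj)].
rewrite !(rmorphB, rmorphD, rmorphM, rmorphXn, rmorph0) /=.
rewrite !rmorph1 !conjCK !conjCi.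
move=> E1 E2; rewrite -(reduced_q0 F); congr reduced_q.
  by rewrite -[RHS]E1; ring.
by rewrite -[RHS]E2; ring.
Qed.

Lemma conj_reduced_q (F : numClosedFieldType) (a b : F) :
  (reduced_q a b) ^t* = (reduced_q a^* b^*)^T.
Proof.
by apply/matrixP => i j; case: i => [[|[|[|//]]] ?]; case: j => [[|[|[|//]]] ?];
rewrite !mxE /= ?rmorphN.
Qed.

Lemma lax_compatible_nls :
  lax_compatible (fun x t => rpotential (q1 x t) (q2 x t) (q1 x t)^* (q2 x t)^*)
                 (fun x t => rpotential1 (q1 x t) (q2 x t) (q1 x t)^* (q2 x t)^*)
  <-> forall x t, nls_q q1 q2 x t.
Proof.
have c1 := smooth2_conj s1; have c2 := smooth2_conj s2.
apply: (iff_trans (lax_compatible_residual s1 s2 c1 c2)); split=> [H x t|H x t].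
  exact: (proj2 (nls_qE x t) (proj1 (H x t))).
have N := proj1 (nls_qE x t) (H x t); split; first exact: N.
rewrite (Dt_conj x t s1) (Dt_conj x t s2) (Dxx_conj x t s1) (Dxx_conj x t s2).
exact: nls_residual_conj.
Qed.

End ReducedLaxPair.

(** * Reduction and scaling *)

Section Reduction.
Variable F : numClosedFieldType.

(** The diagonal blocks are signed permutation matrices, inverted by their transposes. *)
Lemma A1_unit : A1 F \in unitmx.
Proof.
have mul_tr (a : 'M[F]_3) : a \in [:: a1 F; a2 F; a3 F] -> a *m a^T = 1%:M.
  rewrite !inE => /or3P[] /eqP ->; rewrite tr_mx3 mul_mx3;
  apply/matrixP => i j; case: i => [[|[|[|//]]] ?]; case: j => [[|[|[|//]]] ?];
  rewrite !mxE /=; ring.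
suff : A1 F *m block3 (a1 F)^T 0 0 0 (a2 F)^T 0 0 0 (a3 F)^T = 1%:M.
  by case/mulmx1_unit.
rewrite mul_block3 !(mul0mx, mulmx0, addr0, add0r).
rewrite !mul_tr ?inE ?eqxx ?orbT// /block3.
by rewrite row_mx0 col_mx0 -!scalar_mx_block.
Qed.

Lemma mx3_eta (q : 'M[F]_3) : q = mx3
  [:: [:: q 0 0; q 0 1; q 0 2]; [:: q 1 0; q 1 1; q 1 2]; [:: q 2 0; q 2 1; q 2 2]].
Proof.
apply/matrixP => i j; case: i => [[|[|[|//]]] ?]; case: j => [[|[|[|//]]] ?];
by rewrite mxE /=; congr (q _ _); apply: val_inj.
Qed.

(** The (1,2) block of the commutation with [A1] reads a1 q = q a2: each row is the previous one
    times a2, and the last row times a2 is minus the first. Since a2 is an involution, the first row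
    lies in its eigenspace for -1, the vectors (x, y, -x). *)
Lemma Z6_reduced (q p : 'M[F]_3) :
  A1 F *m potential q p *m invmx (A1 F) = potential q p ->
  q = reduced_q (q 0 0) (q 0 1).
Proof.
move=> /(congr1 (fun X => X *m A1 F)); rewrite mulmxKV ?A1_unit//.
rewrite /potential !mul_block3 => /block3_inj[[_ + _] _].
rewrite !(mul0mx, mulmx0, addr0, add0r) {1 2}(mx3_eta q) !mul_mx3.
move=> /matrixP E.
have E00 := E 0 0; have E01 := E 0 1; have E02 := E 0 2.
have E10 := E 1 0; have E11 := E 1 1; have E12 := E 1 2.
have E20 := E 2 0.
move: E00 E01 E02 E10 E11 E12 E20 {E}; rewrite !mxE /=.
rewrite !(mul0r, mul1r, mulr0, mulr1, mulN1r, mulrN1, addr0, add0r).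
move=> q10 q11 q12 q20 q21 q22 q00.
have q02 : q 0 2 = - q 0 0 by rewrite q00 q22.
by rewrite [LHS]mx3_eta /reduced_q q22 q21 q20 q12 q11 q10 q02 opprK.
Qed.

Lemma hermitian_potential (q p : 'M[F]_3) :
  potential q p = (potential q p) ^t* -> p = q ^t*.
Proof.
rewrite {2}/potential /block3 tr_block_mx map_block_mx tr_row_mx map_col_mx.
by move=> /eq_block_mx[_ _ /eq_col_mx[-> _] _].
Qed.

End Reduction.

Section Scaling.
Variable F : numClosedFieldType.

Lemma conj_sqrtC_nat n : (sqrtC n%:R : F)^* = sqrtC n%:R.
Proof. by apply: geC0_conj; rewrite sqrtC_ge0 ler0n. Qed.

Lemma sqrtC_nat_neq0 n : (sqrtC n.+1%:R : F) != 0.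
Proof. by rewrite sqrtC_eq0 pnatr_eq0. Qed.

(** The factors are chosen so that |v1|^2 = 6 |q1|^2 and |v2|^2 = 3 |q2|^2; each equation in v is
    then the equation in q multiplied by the factor of its own field. *)
Lemma nls_scaling (q1 q2 q1t q2t q1xx q2xx : F) :
  let v1 := sqrtC 6 * q1 in let v2 := sqrtC 3 * q2 in
  'i * (sqrtC 6 * q1t) + sqrtC 6 * q1xx + (`|v1| ^+ 2 + 2 * `|v2| ^+ 2) * v1
    - v2 ^+ 2 * v1^* =
  sqrtC 6 * ('i * q1t + q1xx + 6 * (`|q1| ^+ 2 + `|q2| ^+ 2) * q1 - 3 * q2 ^+ 2 * q1^*) /\
  'i * (sqrtC 3 * q2t) + sqrtC 3 * q2xx + (2 * `|v1| ^+ 2 + `|v2| ^+ 2) * v2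
    - v1 ^+ 2 * v2^* =
  sqrtC 3 * ('i * q2t + q2xx + 3 * (4 * `|q1| ^+ 2 + `|q2| ^+ 2) * q2 - 6 * q1 ^+ 2 * q2^*).
Proof.
have := sqrtCK (6 : F); have := sqrtCK (3 : F).
have := conj_sqrtC_nat 6; have := conj_sqrtC_nat 3.
rewrite /= !normCK !rmorphM; move: (sqrtC 6) (sqrtC 3) => s6 s3 /= -> -> E3 E6.
have -> : (2 : F) * (s3 * q2 * (s3 * q2^*)) = 6 * (q2 * q2^*).
  by rewrite mulrACA -expr2 E3; ring.
have -> : s6 * q1 * (s6 * q1^*) = 6 * (q1 * q1^*) by rewrite mulrACA -expr2 E6.
have -> : s3 * q2 * (s3 * q2^*) = 3 * (q2 * q2^*) by rewrite mulrACA -expr2 E3.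
rewrite !exprMn E3 E6; split; ring.
Qed.
End Scaling.

Lemma nls_q_nls_v (R : realType) (q1 q2 : R -> R -> R[i]) x t :
  smooth2 q1 -> smooth2 q2 ->
  nls_q q1 q2 x t <->
  nls_v (fun x t => sqrtC 6 * q1 x t) (fun x t => sqrtC 3 * q2 x t) x t.
Proof.
move=> s1 s2; rewrite /nls_q /nls_v.
have DZx (c : R[i]) (f : R -> R -> R[i]) : smooth2 f -> Dx (fun x t => c * f x t) = (fun x t => c * Dx f x t).
  move=> sf; apply/funext => y; apply/funext => s.
  exact: (cderiveZ c (smooth2_cderivable_x y s sf)).
have DZt (c : R[i]) (f : R -> R -> R[i]) : smooth2 f -> Dt (fun x t => c * f x t) = (fun x t => c * Dt f x t).
  move=> sf; apply/funext => y; apply/funext => s.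
  exact: (cderiveZ c (smooth2_cderivable_t y s sf)).
rewrite (DZx _ _ s1) (DZx _ _ s2) (DZt _ _ s1) (DZt _ _ s2).
rewrite (DZx _ _ (smooth2_Dx s1)) (DZx _ _ (smooth2_Dx s2)).
have [E1 E2] := nls_scaling (q1 x t) (q2 x t) (Dt q1 x t) (Dt q2 x t)
  (Dx (Dx q1) x t) (Dx (Dx q2) x t).
rewrite E1 E2; split=> [[-> ->]|[/eqP + /eqP +]]; first by rewrite !mulr0.
by rewrite !mulf_eq0 !(negPf (sqrtC_nat_neq0 _ _)) => /eqP -> /eqP ->.
Qed.

(** * Bump functions *)

Section SmoothOneVariable.
Variable R : realType.
Implicit Types (f g : R -> R).

(** Differentiability up to order [n.+1], unfolded at the innermost derivative as inductions on
    sums, products and affine changes of variable require. [Cn1_derivable] returns to iterated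
    derivatives. *)
Fixpoint Cn1 n f : Prop :=
  (forall x, derivable f x 1) /\ if n is n'.+1 then Cn1 n' (derive1 f) else True.

Lemma Cn1_derivable f n x : (forall m, Cn1 m f) -> derivable (derive1n n f) x 1.
Proof.
elim: n f => [|n IHn] f sf; first by have [df _] := sf 0%N; exact: df.
by rewrite derive1Sn; apply: IHn => m; have [_] := sf m.+1.
Qed.

Lemma Cn1D n f g : Cn1 n f -> Cn1 n g -> Cn1 n (fun x => f x + g x).
Proof.
elim: n f g => [|n IHn] f g [df cf] [dg cg].
  by split; [move=> x; exact: (derivable1D (df x) (dg x))|exact: I].
split=> [x|]; first exact: (derivable1D (df x) (dg x)).
rewrite (_ : derive1 _ = fun x => derive1 f x + derive1 g x); first exact: IHn.
by apply/funext => x; exact: (derive1D (df x) (dg x)).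
Qed.

Lemma Cn1M n f g : (forall m, Cn1 m f) -> (forall m, Cn1 m g) -> Cn1 n (fun x => f x * g x).
Proof.
elim: n f g => [|n IHn] f g sf sg.
  have df := (sf 0%N).1; have dg := (sg 0%N).1.
  by split; [move=> x; exact: (derivable1M (df x) (dg x))|exact: I].
have df := (sf 0%N).1; have dg := (sg 0%N).1.
have sf' m := (sf m.+1).2; have sg' m := (sg m.+1).2.
split=> [x|]; first exact: (derivable1M (df x) (dg x)).
rewrite (_ : derive1 _ = fun x => derive1 f x * g x + f x * derive1 g x).
  by apply: Cn1D; [exact: (IHn _ _ sf' sg)|exact: (IHn _ _ sf sg')].
by apply/funext => x; exact: (derive1M (df x) (dg x)).
Qed.

Lemma Cn1_cst n (c : R) : Cn1 n (fun=> c).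
Proof.
elim: n c => [|n IHn] c; (split; first by move=> x; exact: (@derivable_cst R R R c x 1)).
  exact: I.
rewrite (_ : derive1 _ = fun=> 0); first exact: IHn.
by apply/funext => x; exact: (@derive1_cst R R c x).
Qed.

Lemma Cn1Z n (c : R) f : Cn1 n f -> Cn1 n (fun x => c * f x).
Proof.
elim: n f => [|n IHn] f [df cf].
  split; last exact: I.
  by move=> x; exact: (derivable1M (@derivable_cst R R R c x 1) (df x)).
split=> [x|]; first exact: (derivable1M (@derivable_cst R R R c x 1) (df x)).
rewrite (_ : derive1 _ = fun x => c * derive1 f x); first exact: IHn.
apply/funext => x; rewrite (derive1M (@derivable_cst R R R c x 1) (df x)).
by rewrite (@derive1_cst R R c x) mul0r add0r.
Qed.

Lemma is_derive_affine (c d x : R) : is_derive x 1 (fun y : R => c * y + d) c.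
Proof.
rewrite -[X in is_derive _ _ _ X]addr0; apply: is_deriveD.
by rewrite -[X in is_derive _ _ _ X]mulr1; exact: is_deriveZ.
Qed.

Lemma is_derive_comp_affine f (c d x : R) : derivable f (c * x + d) 1 ->
  is_derive x 1 (fun y => f (c * y + d)) (derive1 f (c * x + d) * c).
Proof.
move=> df.
exact: (@is_derive1_comp R f (fun y => c * y + d) x _ _ (is_derive1 df)
  (is_derive_affine c d x)).
Qed.

Lemma Cn1_comp_affine n f (c d : R) : (forall m, Cn1 m f) ->
  Cn1 n (fun x => f (c * x + d)).
Proof.
elim: n f => [|n IHn] f sf; have df := (sf 0%N).1.
  split; last exact: I.
  by move=> x; exact: (@ex_derive _ _ _ _ _ _ _ (is_derive_comp_affine (df (c * x + d)))).
split=> [x|]; first exact: (@ex_derive _ _ _ _ _ _ _ (is_derive_comp_affine (df (c * x + d)))).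
rewrite (_ : derive1 _ = fun x => derive1 f (c * x + d) * c); last first.
  apply/funext => x; rewrite derive1E.
  exact: (@derive_val _ _ _ _ _ _ _ (is_derive_comp_affine (df (c * x + d)))).
rewrite [X in Cn1 n X](_ : _ = fun x => (fun=> c) x * derive1 f (c * x + d)).
  exact: (Cn1Z _ (IHn _ (fun m => (sf m.+1).2))).
by apply/funext => x; rewrite mulrC.
Qed.

End SmoothOneVariable.

(** * The flat function exp(-1/x) and bumps built from it *)

Section Flat.
Variable R : realType.

(** The bound forces f 0 = 0 and makes the difference quotient at 0 at most K |h|. *)
Lemma is_derive0_quadratic (f : R -> R) (K : R) :
  (forall x, `|f x| <= K * x ^+ 2) -> is_derive (0 : R) (1 : R) f 0.
Proof.
move=> fK.
have f0 : f 0 = 0 by apply/eqP; rewrite -normr_le0 (le_trans (fK 0))// expr0n mulr0.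
have K0 : 0 <= K by have := fK 1; rewrite expr1n mulr1; exact: le_trans.
suff H : (h^-1 *: ((f \o shift 0) (h *: 1) - f 0)) @[h --> 0^'] --> (0 : R).
  by split; [apply/cvg_ex; exists 0|exact: cvg_lim H].
apply/cvgrPdist_le => e e0.
(* [K] may be 0, and the admissible size of [h] is obtained by dividing by [K + 1]. *)
have K1 : 0 < K + 1 by rewrite ltr_wpDl.
near=> h.
have h0 : h != 0 by near: h; exact: nbhs_dnbhs_neq.
rewrite sub0r normrN /= f0 subr0 addr0 /GRing.scale /= mulr1 normrM normfV.
have hp : 0 < `|h| by rewrite normr_gt0.
rewrite mulrC ler_pdivrMr// (le_trans (fK h))// -real_normK ?num_real// expr2 mulrA.
rewrite ler_pM2r//.
apply: (@le_trans _ _ ((K + 1) * `|h|)); first by rewrite ler_wpM2r// lerDl.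
rewrite mulrC -ler_pdivlMr//.
by near: h; exact: (dnbhs0_le (divr_gt0 e0 K1)).
Unshelve. all: by end_near.
Qed.

(* x^-k exp(-1/x) for x > 0: up to linear combinations, this family is closed
   under differentiation. *)
Definition flat (k : nat) (x : R) : R :=
  if 0 < x then x^-1 ^+ k * expR (- x^-1) else 0.

(** With y = 1/x, the exponential series gives exp y >= y^(k+2) / (k+2)!, hence y^k exp(-y) <=
    (k+2)! y^-2. The two extra powers of y provide the square of x that differentiability at 0
    uses. *)
Lemma flat_bound k x : `|flat k x| <= (k.+2)`!%:R * x ^+ 2.
Proof.
rewrite /flat; case: ltP => [x0|_]; last by rewrite normr0 mulr_ge0// sqr_ge0.
have y0 : 0 < x^-1 by rewrite invr_gt0.
rewrite ger0_norm; last by rewrite mulr_ge0 ?expR_ge0// exprn_ge0// ltW.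
rewrite expRN ler_pdivrMr ?expR_gt0//.
have := expR_ge1Dxn k.+1 (ltW y0).
set E := expR _ => HE.
have {}HE : x^-1 ^+ k.+2 <= k.+2`!%:R * E.
  rewrite mulrC -ler_pdivrMr ?ltr0n ?fact_gt0//.
  by apply: le_trans HE; rewrite lerDr.
have -> : x^-1 ^+ k = x^-1 ^+ k.+2 * x ^+ 2.
  by rewrite -addn2 exprD -mulrA -exprMn mulVf ?gt_eqF// expr1n mulr1.
by rewrite [leRHS]mulrAC ler_wpM2r// sqr_ge0.
Qed.

(** Away from 0 the function coincides locally with 0 or with the explicit product. At 0 the
    quadratic bound, available for every [k], gives derivative 0, which the formula also returns
    there. *)
Lemma is_derive_flat (k : nat) (x : R) :
  is_derive x (1 : R) (flat k) (flat k.+2 x - k%:R * flat k.+1 x).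
Proof.
have [x0|x0|->] := ltgtP x 0.
- rewrite {2 3}/flat ltNge (ltW x0) /= mulr0 subr0.
  have d0 : is_derive x (1 : R) (fun _ : R => 0 : R) (0 : R).
    have := is_derive1 (@derivable_cst R R R 0 x 1).
    by rewrite (@derive1_cst R R 0 x).
  apply: (near_eq_is_derive _ d0).
  near=> y; rewrite /flat ltNge.
  have -> // : y <= 0.
  by near: y; exact: (lt_le_nbhsl x0).
- have xn0 : x != 0 by rewrite gt_eqF.
  have dV : is_derive x (1 : R) (fun y : R => y^-1) (- x ^- 2).
    rewrite -[X in is_derive _ _ _ X]mulr1.
    exact: (@is_deriveV R id x 1 1 xn0 (is_derive_id x (1 : R))).
  have dE := @is_derive1_comp R expR _ x _ _ (is_derive_expR (- x^-1)) (is_deriveN dV).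
  have dX := is_deriveX k dV.
  have dM := is_deriveM dX dE.
  have E : (((fun y : R => y^-1) ^+ k) x *: (expR (- x^-1) * - - x ^- 2) +
       (expR \o - (fun y : R => y^-1)) x *: ((k%:R * x^-1 ^+ k.-1) *: - x ^- 2)) =
       flat k.+2 x - k%:R * flat k.+1 x.
    rewrite /flat x0 /GRing.scale /= exprfctE -exprVn opprK.
    rewrite (_ : (- (fun y : R => y^-1)) x = - x^-1)//.
    by case: (k) => [|n] /=; rewrite ?exprS; ring.
  rewrite E in dM.
  apply: (near_eq_is_derive _ dM).
  near=> y; rewrite /flat.
  have -> : 0 < y by near: y; exact: lt_nbhsr.
  by rewrite -[LHS]/(((fun y : R => y^-1) ^+ k) y * expR (- y^-1)) exprfctE.
- rewrite {2 3}/flat ltxx mulr0 subr0.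
  exact: (is_derive0_quadratic (flat_bound k)).
Unshelve. all: by end_near.
Qed.

Lemma Cn1_flat n k : Cn1 n (flat k).
Proof.
have df k' x : derivable (flat k') x 1.
  exact: (@ex_derive _ _ _ _ _ _ _ (is_derive_flat k' x)).
elim: n k => [|n IHn] k; first by split; [move=> x; exact: df|exact: I].
split; first by move=> x; exact: df.
rewrite (_ : derive1 _ = fun x => flat k.+2 x + (- k%:R) * flat k.+1 x).
  exact: (Cn1D (IHn _) (Cn1Z _ (IHn _))).
apply/funext => x; rewrite derive1E mulNr.
exact: (@derive_val _ _ _ _ _ _ _ (is_derive_flat k x)).
Qed.

(** The slopes 1 and -1 are written out so that both factors have the form handled by
    [Cn1_comp_affine]. *)
Definition bump (a b x : R) : R := flat 0 (1 * x - a) * flat 0 (-1 * x + b).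

Lemma Cn1_bump n a b : Cn1 n (bump a b).
Proof.
apply: Cn1M => m; apply: Cn1_comp_affine => l; exact: Cn1_flat.
Qed.

Lemma flat_gt0 k x : 0 < x -> 0 < flat k x.
Proof. by move=> x0; rewrite /flat x0 mulr_gt0 ?expR_gt0// exprn_gt0// invr_gt0. Qed.

Lemma flat_eq0 k x : x <= 0 -> flat k x = 0.
Proof. by move=> x0; rewrite /flat ltNge x0. Qed.

Lemma bump_gt0 a b x : a < x -> x < b -> 0 < bump a b x.
Proof.
move=> ax xb; apply: mulr_gt0; apply: flat_gt0; first by rewrite mul1r subr_gt0.
by rewrite mulN1r addrC subr_gt0.
Qed.

Lemma bump_eq0 a b x : x <= a \/ b <= x -> bump a b x = 0.
Proof.
rewrite /bump => -[xa|bx].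
  by rewrite [flat _ (1 * x - a)]flat_eq0 ?mul0r// mul1r subr_le0.
by rewrite [flat _ (-1 * x + b)]flat_eq0 ?mulr0// mulN1r addrC subr_le0.
Qed.

Lemma bump_ge0 a b x : 0 <= bump a b x.
Proof.
have [xa|ax] := leP x a; first by rewrite bump_eq0//; left.
have [bx|xb] := leP b x; first by rewrite bump_eq0//; right.
exact: ltW (bump_gt0 ax xb).
Qed.

End Flat.

(** * Integrals of compactly supported functions *)

Section CompactSupport.
Variable R : realType.
Local Notation mu := (@lebesgue_measure R).

Definition csupp (T : nmodType) (f : R -> T) : Prop :=
  exists A : R, forall x, A < `|x| -> f x = 0.

(** [A] may be negative; the radius [|A| + 1] is positive, and the function already vanishes at the
    endpoints of the closed segment it determines. *)
Lemma csupp_ge (T : nmodType) (f : R -> T) A x : (forall x, A < `|x| -> f x = 0) ->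
  `|A| + 1 <= `|x| -> f x = 0.
Proof.
by move=> fA Ax; apply: fA; rewrite (lt_le_trans _ Ax)// ltr_pwDr// ler_norm.
Qed.

Lemma restrict_csupp (f : R -> R) B : (forall x, B <= `|x| -> f x = 0) ->
  f = f \_ `[- B, B].
Proof.
move=> fB; apply/funext => x; rewrite patchE; case: ifPn => //.
rewrite notin_setE /= in_itv /= => /negP xB; apply: fB.
by rewrite leNgt ltr_norml; apply: contra xB => /andP[/ltW -> /ltW ->].
Qed.

Lemma integrable_csupp (f : R -> R) : continuous f -> csupp f ->
  mu.-integrable setT (EFin \o f).
Proof.
move=> cf [A fA]; rewrite (restrict_csupp (fun x => csupp_ge (x := x) fA)).
set B := `|A| + 1.
rewrite (_ : EFin \o _ = (EFin \o f) \_ `[- B, B]); last first.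
  by apply/funext => x; rewrite /= !patchE; case: ifP.
apply: (proj1 (@integrable_mkcond _ _ _ mu `[- B, B] (EFin \o f) (measurable_itv _))).
apply: continuous_compact_integrable; first exact: segment_compact.
exact: continuous_subspaceT.
Qed.

Lemma csupp_derive1 (F : R -> R) : csupp F -> csupp (derive1 F).
Proof.
move=> [A FA]; exists A => x Ax; rewrite derive1E.
have Fx0 : \near x, F x = (fun=> 0 : R) x.
  near=> y; apply: FA; near: y.
  exact: (@cvgr_norm_gt R R R (nbhs x) _ id x cvg_id A Ax).
rewrite (near_eq_derive (1 : R) Fx0) -derive1E; exact: (@derive1_cst R R 0 x).
Unshelve. all: by end_near.
Qed.

Lemma Rintegral_derive_csupp (F : R -> R) : (forall x, derivable F x 1) ->
  continuous (derive1 F) -> csupp F -> \int[mu]_x derive1 F x = 0.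
Proof.
move=> dF cF [A FA].
have csF' : csupp (derive1 F) by apply: csupp_derive1; exists A.
(* [B] bounds both supports: the whole integral of F' is the one over [-B, B], and F vanishes at
   both endpoints, so the fundamental theorem gives 0. *)
have [A' FA'] := csF'; pose B := `|Num.max A A'| + 1.
have B0 : 0 < B by rewrite ltr_wpDl.
have FB x : B <= `|x| -> F x = 0.
  by apply: csupp_ge => y; rewrite gt_max => /andP[/FA].
have FB' x : B <= `|x| -> derive1 F x = 0.
  by apply: csupp_ge => y; rewrite gt_max => /andP[_ /FA'].
rewrite (restrict_csupp FB') -Rintegral_mkcond /Rintegral.
have cvF x : F y @[y --> x] --> F x.
  exact: (differentiable_continuous (proj1 (derivable1_diffP F x) (dF x))).
rewrite (@continuous_FTC2 R (derive1 F) F (- B) B).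
- have nB : `|B| = B by exact: ger0_norm (ltW B0).
  by rewrite (FB B) ?nB// (FB (- B)) ?normrN ?nB// sube0.
- by rewrite gtrN.
- exact: continuous_subspaceT.
- split=> [x _||]; first exact: dF.
    by apply: cvg_at_right_filter; exact: cvF.
  by apply: cvg_at_left_filter; exact: cvF.
- by [].
Qed.

Lemma derivable_continuous (f : R -> R) : (forall x, derivable f x 1) -> continuous f.
Proof.
by move=> df x; exact: (differentiable_continuous (proj1 (derivable1_diffP f x) (df x))).
Qed.

Lemma continuous_bump a b : continuous (@bump R a b).
Proof. exact: (derivable_continuous (Cn1_bump 0 a b).1). Qed.

Lemma csupp_bump a b : csupp (@bump R a b).
Proof.
exists (`|a| + `|b|) => x abx; apply: bump_eq0.
have [xa|ax] := leP x a; first by left.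
have [bx|xb] := leP b x; first by right.
have /andP[aa _] : - `|a| <= a <= `|a| by rewrite -ler_norml.
have /andP[_ bb] : - `|b| <= b <= `|b| by rewrite -ler_norml.
suff : `|x| <= `|a| + `|b| by rewrite leNgt abx.
have a0 := normr_ge0 a; have b0 := normr_ge0 b.
by rewrite ler_norml; apply/andP; split; lra.
Qed.

(** By compactness [h] attains a positive minimum on the segment, and the integral is at least this
    minimum times the length 2e. *)
Lemma Rintegral_gt0 (h : R -> R) (x e : R) : 0 < e -> continuous h -> csupp h ->
  (forall y, 0 <= h y) -> (forall y, y \in `[x - e, x + e] -> 0 < h y) ->
  0 < \int[mu]_y h y.
Proof.
move=> e0 ch sh h0 hI.
have xe : x - e < x + e by rewrite ltrD2l gtrN.
have chI : {within `[x - e, x + e], continuous h} by exact: continuous_subspaceT.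
have [c cI hc] := EVT_min (ltW xe) chI.
have iI : mu.-integrable `[x - e, x + e] (EFin \o h).
  by apply: continuous_compact_integrable => //; exact: segment_compact.
have lb : \int[mu]_(y in `[x - e, x + e]) h c <= \int[mu]_(y in `[x - e, x + e]) h y.
  apply: le_Rintegral => //.
    apply: continuous_compact_integrable; first exact: segment_compact.
    by apply: continuous_subspaceT => y; exact: cst_continuous.
have ub : \int[mu]_(y in `[x - e, x + e]) h y <= \int[mu]_y h y.
  rewrite Rintegral_mkcond; apply: le_Rintegral => //.
  - rewrite (_ : EFin \o _ = (EFin \o h) \_ `[x - e, x + e]); last first.
      by apply/funext => y; rewrite /= !patchE; case: ifP.
    exact: (proj1 (@integrable_mkcond _ _ _ mu _ (EFin \o h) (measurable_itv _)) iI).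
  - exact: integrable_csupp.
  - by move=> y _; rewrite patchE; case: ifP.
apply: lt_le_trans (le_trans lb ub).
rewrite Rintegral_cst//.
rewrite (_ : fine _ = x + e - (x - e)); last first.
  have := lebesgue_measure_itv `[x - e, x + e]; rewrite /= lte_fin xe => mI.
  exact: (congr1 fine mI).
by rewrite /= mulr_gt0 ?hI// subr_gt0.
Qed.

Lemma csuppMr (T : pzRingType) (f g : R -> T) : csupp g -> csupp (fun x => f x * g x).
Proof. by move=> [A gA]; exists A => x Ax; rewrite gA// mulr0. Qed.

(** The fundamental lemma of the calculus of variations. At a point where g is positive it stays
    positive on a ball, and a bump supported in that ball gives a positive integral; a negative
    value is handled by passing to - g. *)
Lemma continuous_eq0_of_orthogonal (g : R -> R) : continuous g ->
  (forall a b, \int[mu]_x (g x * bump a b x) = 0) -> forall x, g x = 0.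
Proof.
have cb (f : R -> R) a b : continuous f -> continuous (fun y => f y * bump a b y).
  by move=> cf y; apply: continuousM; [exact: cf|exact: continuous_bump].
suff pos (f : R -> R) x : continuous f ->
    (forall a b, \int[mu]_x (f x * bump a b x) = 0) -> 0 < f x -> False.
  move=> cg g0 x; apply/eqP; case: (ltgtP (g x) 0) => // gx; exfalso.
    apply: (pos (fun y => - g y) x); last by rewrite oppr_gt0.
      by move=> y; apply: continuousN; exact: cg.
    move=> a b; rewrite (_ : (fun y => _) = fun y => g y * bump a b y * -1).
      rewrite RintegralZr// ?g0 ?mul0r//.
      by apply: integrable_csupp; [exact: cb|exact/csuppMr/csupp_bump].
    by apply/funext => y; rewrite mulrN1 mulNr.
  exact: pos gx.
move=> cf f0 fx.
have nf : nbhs x [set y | 0 < f y] by exact: (cvgr_gt (f x) (cf x) 0 fx).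
have [d /= d0 fd] := proj1 (nbhs_ballP x _) nf.
have fpos y : x - d < y -> y < x + d -> 0 < f y.
  move=> xy yx; apply: fd; rewrite /ball /= distrC ltr_norml.
  by apply/andP; split; [rewrite ltrBrDl; exact: xy|rewrite ltrBlDl; exact: yx].
(* Half the radius, so that the closed segment lies where both [f] and the bump are positive. *)
have d20 : 0 < d / 2 by rewrite divr_gt0.
have dd : d / 2 < d by rewrite ltr_pdivrMr// ltr_pMr// ltr1n.
suff : 0 < \int[mu]_y (f y * bump (x - d) (x + d) y) by rewrite f0 ltxx.
apply: (@Rintegral_gt0 _ x (d / 2)) => //.
- exact: cb.
- exact/csuppMr/csupp_bump.
- move=> y; have [yx|xy] := leP y (x - d).
    by rewrite bump_eq0 ?mulr0//; left.
  have [xy'|yx] := leP (x + d) y.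
    by rewrite bump_eq0 ?mulr0//; right.
  by rewrite mulr_ge0 ?bump_ge0// ltW// fpos.
- move=> y; rewrite in_itv /= => /andP[xy yx].
  have xy' : x - d < y by apply: lt_le_trans xy; rewrite ltrD2l ltrN2.
  have yx' : y < x + d by apply: (le_lt_trans yx); rewrite ltrD2l.
  by rewrite mulr_gt0 ?bump_gt0// fpos.
Qed.

End CompactSupport.

(** * Complex integrals and test functions *)

Section ComplexIntegral.
Variable R : realType.
Local Notation C := R[i].
Local Notation re := (@complex.Re R).
Local Notation im := (@complex.Im R).
Local Notation mu := (@lebesgue_measure R).
Implicit Types (f g : R -> C).

Lemma re_csupp f : csupp f -> csupp (re \o f).
Proof. by move=> [A fA]; exists A => x Ax; rewrite /= fA. Qed.

Lemma im_csupp f : csupp f -> csupp (im \o f).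
Proof. by move=> [A fA]; exists A => x Ax; rewrite /= fA. Qed.

Lemma csupp_cderive f : csupp f -> csupp (cderive f).
Proof.
move=> sf; have [A fA] := csupp_derive1 (re_csupp sf).
have [B fB] := csupp_derive1 (im_csupp sf); exists (Num.max A B) => x.
by rewrite gt_max => /andP[Ax Bx]; rewrite /cderive fA// fB.
Qed.

Definition cdiff f := forall x, cderivable f x.

Lemma cdiff_continuous f : cdiff f -> continuous (re \o f) /\ continuous (im \o f).
Proof.
by move=> df; split; apply: derivable_continuous => x; [exact: (df x).1|exact: (df x).2].
Qed.

Lemma cintegrable_csupp f : cdiff f -> csupp f -> cintegrable f.
Proof.
move=> /cdiff_continuous[c1 c2] sf; split.
  exact: integrable_csupp c1 (re_csupp sf).
exact: integrable_csupp c2 (im_csupp sf).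
Qed.

Lemma cintegrableD f g : cintegrable f -> cintegrable g ->
  cintegrable (fun x => f x + g x).
Proof.
move=> [f1 f2] [g1 g2]; split.
  rewrite comp_ReD (_ : EFin \o _ = (EFin \o (re \o f)) \+ (EFin \o (re \o g)))%E//.
  exact: integrableD.
rewrite comp_ImD (_ : EFin \o _ = (EFin \o (im \o f)) \+ (EFin \o (im \o g)))%E//.
exact: integrableD.
Qed.

Lemma cintegralD f g : cintegrable f -> cintegrable g ->
  cintegral (fun x => f x + g x) = cintegral f + cintegral g.
Proof.
move=> [f1 f2] [g1 g2]; apply: eq_complexP.
  rewrite cReD /cintegral [in LHS]/complex.Re -(@RintegralD _ _ _ mu setT (re \o f) (re \o g))//.
  by apply: eq_Rintegral => x _; exact: cReD.
rewrite cImD /cintegral [in LHS]/complex.Im -(@RintegralD _ _ _ mu setT (im \o f) (im \o g))//.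
by apply: eq_Rintegral => x _; exact: cImD.
Qed.

Lemma cintegralZ (c : R) f : cintegrable f ->
  cintegral (fun x => c%:C%C * f x) = c%:C%C * cintegral f.
Proof.
move=> [f1 f2]; apply: eq_complexP.
  rewrite cReM /= mul0r subr0 -(@RintegralZl _ _ _ mu setT (re \o f) c)//.
  by apply: eq_Rintegral => x _; rewrite cReM /= mul0r subr0.
rewrite cImM /= mul0r addr0 -(@RintegralZl _ _ _ mu setT (im \o f) c)//.
by apply: eq_Rintegral => x _; rewrite cImM /= mul0r addr0.
Qed.

Lemma cintegrableZ (c : R) f : cintegrable f -> cintegrable (fun x => c%:C%C * f x).
Proof.
move=> [f1 f2]; split.
  rewrite (_ : EFin \o _ = fun x => (c%:E * (EFin \o (re \o f)) x)%E).
    exact: integrableZl.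
  by apply/funext => x; rewrite /= cReM /= mul0r subr0.
rewrite (_ : EFin \o _ = fun x => (c%:E * (EFin \o (im \o f)) x)%E).
  exact: integrableZl.
by apply/funext => x; rewrite /= cImM /= mul0r addr0.
Qed.

Lemma cintegral_cderive f : cdiff f -> cdiff (cderive f) -> csupp f ->
  cintegral (cderive f) = 0.
Proof.
move=> df /cdiff_continuous[c1 c2] sf; apply: eq_complexP.
  exact: (Rintegral_derive_csupp (fun x => (df x).1) c1 (re_csupp sf)).
exact: (Rintegral_derive_csupp (fun x => (df x).2) c2 (im_csupp sf)).
Qed.

Lemma test_function_bump a b : test_function (fun x => (bump a b x)%:C%C : C).
Proof.
split; last by have [A bA] := csupp_bump a b; exists A => x Ax; rewrite bA.
move=> n x; split.
  rewrite (_ : re \o _ = bump a b); last by apply/funext.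
  exact: (Cn1_derivable (fun m => Cn1_bump m a b)).
rewrite (_ : im \o _ = fun=> 0 : R); last by apply/funext.
exact: (Cn1_derivable (fun m => Cn1_cst m (0 : R))).
Qed.

(** Real-valued bumps are tested, so the real and imaginary parts of the integral separate and each
    reduces to the real case. *)
Lemma cdiff_eq0_of_orthogonal f : cdiff f ->
  (forall eta, test_function eta -> cintegral (fun x => f x * eta x) = 0) ->
  forall x, f x = 0.
Proof.
move=> /cdiff_continuous[c1 c2] f0 x; apply: eq_complexP.
  apply: (continuous_eq0_of_orthogonal c1) => a b.
  have /(congr1 re) := f0 _ (test_function_bump a b); rewrite /= => E.
  rewrite -[RHS]E; apply: eq_Rintegral => y _.
  by rewrite cReM /= mulr0 subr0.
apply: (continuous_eq0_of_orthogonal c2) => a b.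
have /(congr1 im) := f0 _ (test_function_bump a b); rewrite /= => E.
rewrite -[RHS]E; apply: eq_Rintegral => y _.
by rewrite cImM /= mulr0 add0r.
Qed.

Lemma cdiffD f g : cdiff f -> cdiff g -> cdiff (fun x => f x + g x).
Proof. by move=> df dg x; exact: (cderivableD (df x) (dg x)). Qed.

Lemma cdiffM f g : cdiff f -> cdiff g -> cdiff (fun x => f x * g x).
Proof. by move=> df dg x; exact: (cderivableM (df x) (dg x)). Qed.

Lemma cdiffZ c f : cdiff f -> cdiff (fun x => c * f x).
Proof. by move=> df x; exact: (cderivableZ c (df x)). Qed.

Lemma cdiffN f : cdiff f -> cdiff (fun x => - f x).
Proof. by move=> df; under eq_fun do rewrite -mulN1r; exact: (cdiffZ (-1) df). Qed.

Lemma cdiff_conj f : cdiff f -> cdiff (fun x => (f x)^*).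
Proof. by move=> df x; exact: (cderivable_conj (df x)). Qed.

Lemma test_function_cdiff f : test_function f ->
  [/\ cdiff f, cdiff (cderive f) & csupp f].
Proof.
move=> [sf cf]; split=> // x; split.
- exact: (sf 0%N x).1.
- exact: (sf 0%N x).2.
- exact: (sf 1%N x).1.
- exact: (sf 1%N x).2.
Qed.

End ComplexIntegral.

(** * Hamiltonian form *)

Section FirstVariation.
Variable R : realType.
Local Notation C := R[i].

(** The density of H' as a polynomial in eight independent values, [w] and [z] standing for the
    conjugates of [v] and [u], and [dv], [du], [dw], [dz] for derivatives. Expansions along a
    variation become polynomial identities. *)
Definition energy_density (F : fieldType) (v u w z dv du dw dz : F) : F :=
  dv * dw + du * dz - 2^-1 * (v * w + u * z) ^+ 2 + 2^-1 * (v * z - w * u) ^+ 2.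

(* Exchanging the two fields reduces the variation in v_2^* to that in v_1^*. *)
Lemma energy_density_sym (F : fieldType) (v u w z dv du dw dz : F) :
  energy_density u v z w du dv dz dw = energy_density v u w z dv du dw dz.
Proof. rewrite /energy_density; ring. Qed.

(** The kinetic part is linear in the shifted field, so the term of second order in [e] comes from
    the two squares alone. *)
Lemma energy_density_expansion (F : fieldType) (v u w z dv du dw dz e h dh : F) :
  (2 : F) != 0 ->
  energy_density v u (w + e * h) z dv du (dw + e * dh) dz =
  energy_density v u w z dv du dw dz
  + e * (dv * dh - ((v * w + u * z) * v + (v * z - w * u) * u) * h)
  + e * (e * (2^-1 * (u * u - v * v) * h * h)).
Proof. by move=> n2; rewrite /energy_density; field. Qed.

(** The Euler-Lagrange expression for the conjugate of [v], kept as it arises from the two squares.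
    It simplifies to minus the sum of v_xx, (|v|^2 + 2 |u|^2) v and - u^2 times the conjugate of
    v. *)
Definition variational_gradient (v u : R -> C) (x : R) : C :=
  - cderive (cderive v) x
  - ((v x * (v x)^* + u x * (u x)^*) * v x + (v x * (u x)^* - (v x)^* * u x) * u x).

Section Variation.
Variables v u : R -> C.
Hypotheses (dv : cdiff v) (dv' : cdiff (cderive v)) (dv'' : cdiff (cderive (cderive v))).
Hypothesis du : cdiff u.

Let energy (w dw : R -> C) : R -> C := fun x =>
  energy_density (v x) (u x) (w x) (u x)^* (cderive v x) (cderive u x) (dw x) (cderive u x)^*.

Hypothesis H0 : cintegrable (energy (fun x => (v x)^*) (fun x => (cderive v x)^*)).

Lemma cdiff_variational_gradient : cdiff (variational_gradient v u).
Proof.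
have dvc := cdiff_conj dv; have duc := cdiff_conj du.
exact: (cdiffD (cdiffN dv'') (cdiffN (cdiffD
  (cdiffM (cdiffD (cdiffM dv dvc) (cdiffM du duc)) dv)
  (cdiffM (cdiffD (cdiffM dv duc) (cdiffN (cdiffM dvc du))) du)))).
Qed.

Let F (eta : R -> C) (e : R) : C := cintegral (energy
  (fun x => (v x)^* + e%:C%C * eta x) (fun x => (cderive v x)^* + e%:C%C * cderive eta x)).

(** The terms containing [eta] are differentiable with compact support, hence integrable. Together
    with [H0] for the unperturbed density, this justifies splitting the integral for every e. *)
Lemma first_variation (eta : R -> C) : test_function eta ->
  is_cderive (F eta) 0 (cintegral (fun x => variational_gradient v u x * eta x)).
Proof.
move=> /test_function_cdiff[de de' se].
have dvc := cdiff_conj dv; have duc := cdiff_conj du.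
have se' := csupp_cderive se.
(* The energy at v^* + e eta is H0 + e (int h1) + e^2 (int h2), and h1 differs
   from the gradient times eta by the total derivative of v' eta. *)
pose h1 x := cderive v x * cderive eta x
  - ((v x * (v x)^* + u x * (u x)^*) * v x + (v x * (u x)^* - (v x)^* * u x) * u x) * eta x.
pose h2 x := 2^-1 * (u x * u x - v x * v x) * eta x * eta x.
pose ge x := variational_gradient v u x * eta x.
pose vx x := cderive v x * eta x.
have ige : cintegrable ge.
  exact: (cintegrable_csupp (cdiffM cdiff_variational_gradient de) (csuppMr _ se)).
have dvx : cdiff vx by exact: (cdiffM dv' de).
have svx : csupp vx by exact: (csuppMr _ se).
have vxE : cderive vx = fun x => cderive (cderive v) x * eta x + cderive v x * cderive eta x.
  by apply/funext => x; exact: (cderiveM (dv' x) (de x)).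
have dvx' : cdiff (cderive vx).
  by rewrite vxE; exact: (cdiffD (cdiffM dv'' de) (cdiffM dv' de')).
have h1E : h1 = fun x => ge x + cderive vx x.
  by apply/funext => x; rewrite vxE /h1 /ge /variational_gradient; ring.
have ivx : cintegrable (cderive vx).
  exact: (cintegrable_csupp dvx' (csupp_cderive svx)).
have I1 : cintegral h1 = cintegral ge.
  by rewrite h1E (cintegralD ige ivx) (cintegral_cderive dvx dvx' svx) addr0.
have i1 : cintegrable h1 by rewrite h1E; exact: (cintegrableD ige ivx).
have i2 : cintegrable h2.
  apply: (cintegrable_csupp _ (csuppMr _ se)).
  apply: (cdiffM (cdiffM _ de) de); apply: cdiffZ.
  exact: (cdiffD (cdiffM du du) (cdiffN (cdiffM dv dv))).
rewrite -/ge -I1.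
have -> : F eta = fun e => cintegral (energy (fun x => (v x)^*) (fun x => (cderive v x)^*))
    + e%:C%C * cintegral h1 + e%:C%C * (e%:C%C * cintegral h2).
  apply/funext => e.
  have ie1 := cintegrableZ e i1; have ie2 := cintegrableZ e i2.
  rewrite -(cintegralZ e i1) -(cintegralZ e i2) -(cintegralZ e ie2).
  rewrite -(cintegralD H0 ie1) -(cintegralD (cintegrableD H0 ie1) (cintegrableZ e ie2)).
  congr cintegral; apply/funext => x.
  by rewrite /energy energy_density_expansion// pnatr_eq0.
set I0 := cintegral _.
have did : cdiff (fun e : R => e%:C%C : C).
  by move=> x; split; [exact: (@derivable_id R R x 1)|exact: (@derivable_cst R R R 0 x 1)].
have cid : cderive (fun e : R => e%:C%C : C) 0 = 1.
  apply: eq_complexP; first exact: (derive1_id (0 : R)).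
  exact: (@derive1_cst R R 0 0).
have dc c : cdiff (fun e : R => e%:C%C * c : C).
  by move=> x; exact: (cderivableM (did x) (cderivable_cst c x)).
have d2 : cdiff (fun e : R => e%:C%C * (e%:C%C * cintegral h2) : C) by exact: (cdiffM did (dc _)).
have d01 : cdiff (fun e : R => I0 + e%:C%C * cintegral h1).
  by move=> x; exact: (cderivableD (cderivable_cst I0 x) (dc _ x)).
have := is_cderiveP (cderivableD (d01 0) (d2 0)).
rewrite (cderiveD (d01 0) (d2 0)) (cderiveD (cderivable_cst I0 0) (dc _ 0)).
rewrite cderive_cst add0r (cderiveM (did 0) (dc _ 0)).
rewrite (cderiveM (did 0) (cderivable_cst (cintegral h1) 0)) cid cderive_cst.
by rewrite mulr0 addr0 mul1r mul1r !mul0r !addr0.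
Qed.

(** A derivative at 0 is unique, so g and the gradient have equal integrals against every test
    function; the fundamental lemma applied to their difference makes them equal pointwise. *)
Lemma first_variation_eqP (g : R -> C) : cdiff g ->
  (forall eta, test_function eta -> cintegrable (fun x => g x * eta x) /\
     is_cderive (F eta) 0 (cintegral (fun x => g x * eta x))) <->
  forall x, g x = variational_gradient v u x.
Proof.
move=> dg; have dG := cdiff_variational_gradient; split=> [H|gE eta te].
  move=> x; apply/eqP; rewrite -subr_eq0; apply/eqP; move: x.
  apply: (cdiff_eq0_of_orthogonal (cdiffD dg (cdiffN dG))) => eta te.
  have [ig dF] := H eta te; have dF' := first_variation te.
  have [de de' se] := test_function_cdiff te.
  have iG := cintegrable_csupp (cdiffM dG de) (csuppMr _ se).
  have E := is_cderive_uniq dF dF'.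
  have inG : cintegrable (fun x => - (variational_gradient v u x * eta x)).
    by apply: (cintegrable_csupp (cdiffN (cdiffM dG de))); have [A sA] := se;
      exists A => x Ax; rewrite sA// mulr0 oppr0.
  rewrite (_ : (fun x => _) = fun x => g x * eta x + - (variational_gradient v u x * eta x)).
    rewrite (cintegralD ig inG) E -(cintegralD iG inG).
    (* The zero integrand is written as 0 times an integrable function, so that linearity yields its
       integral. *)
    rewrite (_ : (fun x => _) = fun x => 0%:C%C * (g x * eta x)).
      by rewrite (cintegralZ 0 ig) mul0r.
    by apply/funext => x; rewrite subrr mul0r.
  by apply/funext => x; rewrite mulrDl mulNr.
have -> : g = variational_gradient v u by apply/funext.
split; last exact: first_variation.
have [de de' se] := test_function_cdiff te.
exact: (cintegrable_csupp (cdiffM dG de) (csuppMr _ se)).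
Qed.
End Variation.
End FirstVariation.

(** * Variational derivatives of H' and the equations for v1, v2 *)

Section Hamiltonian.
Variable R : realType.
Local Notation C := R[i].

Lemma hamiltonian_densityE (v w : 'I_2 -> R -> C) x :
  hamiltonian_density v w x = energy_density (v 0 x) (v 1 x) (w 0 x) (w 1 x)
    (cderive (v 0) x) (cderive (v 1) x) (cderive (w 0) x) (cderive (w 1) x).
Proof. by []. Qed.

Lemma cderive_conjE (f : R -> C) x : cdiff f -> cderive (fun y => (f y)^*) x = (cderive f x)^*.
Proof. by move=> df; exact: (@cderive_conj R f x (df x).2). Qed.

Lemma cderive_conj_add (f eta : R -> C) (e : C) x : cdiff f -> cdiff eta ->
  cderive (fun y => (f y)^* + e * eta y) x = (cderive f x)^* + e * cderive eta x.
Proof.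
move=> df de; rewrite (cderiveD (cdiff_conj df x) (cdiffZ e de x)).
by rewrite (cderive_conjE x df) (cderiveZ e (de x)).
Qed.

Variables v1 v2 : R -> R -> C.
Hypotheses (s1 : smooth2 v1) (s2 : smooth2 v2).

Lemma smooth2_slice (f : R -> R -> C) t : smooth2 f -> cdiff (f^~ t).
Proof. by move=> sf x; exact: smooth2_cderivable_x. Qed.

Let d1 t := smooth2_slice t s1.
Let d2 t := smooth2_slice t s2.

Lemma hamiltonian_shift0 t (eta : R -> C) (e : C) : cdiff eta ->
  hamiltonian (state2 v1 v2 t)
    (shift_state (conj_state (state2 v1 v2 t)) 0 (fun x => e * eta x)) =
  cintegral (fun x => energy_density (v1 x t) (v2 x t) ((v1 x t)^* + e * eta x) (v2 x t)^*
    (cderive (v1^~ t) x) (cderive (v2^~ t) x)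
    ((cderive (v1^~ t) x)^* + e * cderive eta x) (cderive (v2^~ t) x)^*).
Proof.
move=> de; congr cintegral; apply/funext => x; rewrite hamiltonian_densityE.
rewrite -(cderive_conj_add e x (d1 t) de) -(cderive_conjE x (d2 t)).
by [].
Qed.

(** The two fields are listed in exchanged order, so that this component is an instance of the first
    variation with the roles of v1 and v2 swapped. *)
Lemma hamiltonian_shift1 t (eta : R -> C) (e : C) : cdiff eta ->
  hamiltonian (state2 v1 v2 t)
    (shift_state (conj_state (state2 v1 v2 t)) 1 (fun x => e * eta x)) =
  cintegral (fun x => energy_density (v2 x t) (v1 x t) ((v2 x t)^* + e * eta x) (v1 x t)^*
    (cderive (v2^~ t) x) (cderive (v1^~ t) x)
    ((cderive (v2^~ t) x)^* + e * cderive eta x) (cderive (v1^~ t) x)^*).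
Proof.
move=> de; congr cintegral; apply/funext => x; rewrite hamiltonian_densityE.
rewrite -(cderive_conj_add e x (d2 t) de) -(cderive_conjE x (d1 t)).
exact: energy_density_sym.
Qed.

Lemma nls_v_gradient x t : nls_v v1 v2 x t <->
  'i * Dt v1 x t = variational_gradient (v1^~ t) (v2^~ t) x /\
  'i * Dt v2 x t = variational_gradient (v2^~ t) (v1^~ t) x.
Proof.
have grad (F : comNzRingType) (g w v u vc uc : F) :
    g + w + (v * vc + 2 * (u * uc)) * v - u ^+ 2 * vc = 0 <->
    g = - w - ((v * vc + u * uc) * v + (v * uc - vc * u) * u).
  split=> [E|->]; last ring.
  by apply/eqP; rewrite -subr_eq0; apply/eqP; rewrite -[RHS]E; ring.
rewrite /nls_v (normCK (v1 x t)) (normCK (v2 x t)).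
(* This gives the second equation the shape of the first with the fields exchanged, so that [grad]
   covers both. *)
rewrite [2 * _ + v2 x t * (v2 x t)^*]addrC.
split=> [[E1 E2]|[E1 E2]]; split.
- exact: (proj1 (grad _ _ _ _ _ _ _) E1).
- exact: (proj1 (grad _ _ _ _ _ _ _) E2).
- exact: (proj2 (grad _ _ _ _ _ _ _) E1).
- exact: (proj2 (grad _ _ _ _ _ _ _) E2).
Qed.

Hypothesis H0 : forall t, cintegrable (hamiltonian_density (state2 v1 v2 t)
                                  (conj_state (state2 v1 v2 t))).

Let i1 t : cintegrable (fun x => energy_density (v1 x t) (v2 x t) (v1 x t)^* (v2 x t)^*
    (cderive (v1^~ t) x) (cderive (v2^~ t) x)
    (cderive (v1^~ t) x)^* (cderive (v2^~ t) x)^*).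
Proof.
rewrite (_ : (fun x => _) = hamiltonian_density (state2 v1 v2 t)
                                  (conj_state (state2 v1 v2 t))); first exact: H0.
apply/funext => x; rewrite hamiltonian_densityE.
by rewrite -(cderive_conjE x (d1 t)) -(cderive_conjE x (d2 t)).
Qed.

Let i2 t : cintegrable (fun x => energy_density (v2 x t) (v1 x t) (v2 x t)^* (v1 x t)^*
    (cderive (v2^~ t) x) (cderive (v1^~ t) x)
    (cderive (v2^~ t) x)^* (cderive (v1^~ t) x)^*).
Proof. by under eq_fun do rewrite energy_density_sym; exact: i1. Qed.

Lemma ord2P (j : 'I_2) : j = 0 \/ j = 1.
Proof. by case: j => [[|[|//]] ?]; [left|right]; apply: val_inj. Qed.

Lemma nls_v_hamiltonian_eqs : (forall x t, nls_v v1 v2 x t) <-> hamiltonian_eqs v1 v2.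
Proof.
have d1' t := smooth2_slice t (smooth2_Dx s1).
have d1'' t := smooth2_slice t (smooth2_Dx (smooth2_Dx s1)).
have d2' t := smooth2_slice t (smooth2_Dx s2).
have d2'' t := smooth2_slice t (smooth2_Dx (smooth2_Dx s2)).
have dt1 t := smooth2_slice t (smooth2Z 'i (smooth2_Dt s1)).
have dt2 t := smooth2_slice t (smooth2Z 'i (smooth2_Dt s2)).
have P1 t := first_variation_eqP (d1 t) (d1' t) (d1'' t) (d2 t) (i1 t) (dt1 t).
have P2 t := first_variation_eqP (d2 t) (d2' t) (d2'' t) (d1 t) (i2 t) (dt2 t).
(* The formulas for the shifted H' hold for differentiable [eta], so the functional is replaced
   under the quantifier over test functions. *)
have shiftE t (j : 'I_2) (F : (R -> C) -> R -> C) (g : R -> C) :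
    (forall eta e, test_function eta ->
      hamiltonian (state2 v1 v2 t) (shift_state (conj_state (state2 v1 v2 t)) j
        (fun x => e%:C%C * eta x)) = F eta e) ->
    (is_var_deriv_conj (@hamiltonian R) (state2 v1 v2 t) j g <->
     forall eta, test_function eta -> cintegrable (fun x => g x * eta x) /\
       is_cderive (F eta) 0 (cintegral (fun x => g x * eta x))).
  move=> FE; have Fe eta : test_function eta -> F eta = fun eps : R =>
      hamiltonian (state2 v1 v2 t) (shift_state (conj_state (state2 v1 v2 t)) j
        (fun x => eps%:C%C * eta x)).
    by move=> te; apply/funext => e; rewrite FE.
  split=> H eta te; have [ig dF] := H eta te; (split; first exact: ig).
    by rewrite (Fe _ te).
  by rewrite -(Fe _ te).
split=> [H t j|H x t].
  have E1 := fun x => proj1 (proj1 (nls_v_gradient x t) (H x t)).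
  have E2 := fun x => proj2 (proj1 (nls_v_gradient x t) (H x t)).
  case: (ord2P j) => ->.
    apply: (proj2 (shiftE t 0 _ _ (fun eta e te =>
      hamiltonian_shift0 t e%:C%C (let: And3 a _ _ := test_function_cdiff te in a)))).
    exact: (proj2 (P1 t) E1).
  apply: (proj2 (shiftE t 1 _ _ (fun eta e te =>
      hamiltonian_shift1 t e%:C%C (let: And3 a _ _ := test_function_cdiff te in a)))).
  exact: (proj2 (P2 t) E2).
apply: (proj2 (nls_v_gradient x t)); split.
  apply: (proj1 (P1 t)); apply: (proj1 (shiftE t 0 _ _ (fun eta e te =>
      hamiltonian_shift0 t e%:C%C (let: And3 a _ _ := test_function_cdiff te in a)))).
  exact: (H t 0).
apply: (proj1 (P2 t)); apply: (proj1 (shiftE t 1 _ _ (fun eta e te =>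
      hamiltonian_shift1 t e%:C%C (let: And3 a _ _ := test_function_cdiff te in a)))).
exact: (H t 1).
Qed.
End Hamiltonian.

(** Lets q1 and q2 be read off as entries of Q, so that the smoothness assumed of Q passes to
    them. *)
Lemma potential_entry (F : fieldType) (q p : 'M[F]_3) (i j : 'I_3) :
  potential q p (lshift (3 + 3) i) (rshift 3 (lshift 3 j)) = q i j.
Proof. by rewrite /potential /block3 block_mxEur row_mxEl. Qed.

Theorem mainTheorem1 (R : realType)
    (Q : R -> R -> 'M[R[i]]_(3 + (3 + 3))) (q p : R -> R -> 'M[R[i]]_3)
    (Qsmooth : mxsmooth Q)
    (Qso9 : forall x t, in_so9 (Q x t))
    (Qblock : forall x t, Q x t = potential (q x t) (p x t))
    (QZ6 : forall x t, A1 R[i] *m Q x t *m invmx (A1 R[i]) = Q x t)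
    (QZ2 : forall x t, Q x t = (Q x t) ^t*) :
  (exists q1 q2 : R -> R -> R[i], forall x t,
      q x t = reduced_q (q1 x t) (q2 x t) /\ p x t = (q x t) ^t*) /\
  (forall q1 q2 : R -> R -> R[i],
      (forall x t, q x t = reduced_q (q1 x t) (q2 x t)) ->
      (lax_compatible Q (fun x t => potential1 (q x t) (p x t)) <->
         forall x t, nls_q q1 q2 x t) /\
      (let v1 := fun x t => sqrtC 6 * q1 x t in
       let v2 := fun x t => sqrtC 3 * q2 x t in
       (forall x t, nls_q q1 q2 x t <-> nls_v v1 v2 x t) /\
       ((forall t, cintegrable (hamiltonian_density (state2 v1 v2 t)
                                  (conj_state (state2 v1 v2 t)))) ->
        ((forall x t, nls_v v1 v2 x t) <-> hamiltonian_eqs v1 v2)))).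
Proof.
have Qq x t : q x t = reduced_q (q x t 0 0) (q x t 0 1).
  by apply: (Z6_reduced (p := p x t)); have := QZ6 x t; rewrite Qblock.
have Qp x t : p x t = (q x t) ^t*.
  by apply: hermitian_potential; have := QZ2 x t; rewrite Qblock.
split.
  exists (fun x t => q x t 0 0), (fun x t => q x t 0 1) => x t.
  by split; [exact: Qq|exact: Qp].
move=> q1 q2 qE.
have entry x t j : Q x t (lshift (3 + 3) 0) (rshift 3 (lshift 3 j)) = q x t 0 j.
  by rewrite Qblock potential_entry.
have sq1 : smooth2 q1.
  have := Qsmooth (lshift (3 + 3) 0) (rshift 3 (lshift 3 0)).
  rewrite (_ : (fun x t => _) = q1)//.
  by apply/funext => x; apply/funext => t; rewrite entry qE mxE.
have sq2 : smooth2 q2.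
  have := Qsmooth (lshift (3 + 3) 0) (rshift 3 (lshift 3 1)).
  rewrite (_ : (fun x t => _) = q2)//.
  by apply/funext => x; apply/funext => t; rewrite entry qE mxE.
have pE x t : p x t = (reduced_q (q1 x t)^* (q2 x t)^*)^T.
  by rewrite Qp qE conj_reduced_q.
split.
  have -> : Q = (fun x t => rpotential (q1 x t) (q2 x t) (q1 x t)^* (q2 x t)^*).
    by apply/funext => x; apply/funext => t; rewrite Qblock qE pE.
  have -> : (fun x t => potential1 (q x t) (p x t)) =
      (fun x t => rpotential1 (q1 x t) (q2 x t) (q1 x t)^* (q2 x t)^*).
    by apply/funext => x; apply/funext => t; rewrite qE pE.
  exact: lax_compatible_nls.
move=> v1 v2; split=> [x t|H0]; first exact: nls_q_nls_v.
exact: (nls_v_hamiltonian_eqs (smooth2Z (sqrtC 6) sq1) (smooth2Z (sqrtC 3) sq2) H0).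
Qed.
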